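(* Let $n\ge2$, $\Gamma=\mathrm{SL}_n(\mathbb{Z})$, $X=\Gamma\backslash\mathrm{SL}_n(\mathbb{R})$, let $1\le m<n$, $d=m(n-m)$, and let $u:\mathbb{R}^d\to U$ be the associated abelian horospherical flow. Let $K=\mathrm{diag}(K_1,\dots,K_d)$ with $T\ge K_1,\dots,K_d\ge1$ real, and let $|K|=K_1K_2\cdots K_d$ be its determinant. Set $$C_K:=\max\left(C,\ \left(\frac{2}{\min_iK_i}\right)^{(d+1)/b}|K|^{1/b}\right).$$ Then for all $x_0=\Gamma g_0\in X$ satisfying the Diophantine condition $\mathrm{Dio}(T,R)$ with $T>R>C_K$, and all $f\in C_c^\infty(X)$, we have $$\left|\sum_{\substack{\mathbf k\in\mathbb{Z}^d\\ K\mathbf k\in B_T}}f(x_0u(K\mathbf k))-\frac{T^d}{|K|}\int_Xf\,dm_X\right|\ll\left(T^dR^{-b/(d+1)}|K|^{-d/(d+1)}+\frac{T^{d-1}\max_iK_i}{|K|}\right)\mathcal{S}_{\infty,\ell}(f),$$ where $\ell=n(n-1)/2$ and the implied constant depends only on $n$ and $d$.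
   Context: $U=\left\{\begin{pmatrix}I_m&*\\0&I_{n-m}\end{pmatrix}\right\}$ and $u:\mathbb{R}^d\to U$ is the group isomorphism given by an identification of the coordinates of $\mathbf t$ with the entries of the upper-right block (one per entry). $B_T=[0,T]^d\subset\mathbb{R}^d$, also identified with $u([0,T]^d)\subset U$. $m_X$ is the invariant probability measure on $X$. $G=\mathrm{SL}_n(\mathbb{R})$ acts on $\Lambda^j(\mathbb{R}^n)$ on the right by $(e_{i_1}\wedge\cdots\wedge e_{i_j})g=(e_{i_1}g)\wedge\cdots\wedge(e_{i_j}g)$; for $w=\sum_Iw_Ie_I$ in the standard basis, $\|w\|=\max_I|w_I|$; $\Lambda^j(\mathbb{Z}^n)$ is the set of integer combinations of the $e_I$. Condition $\mathrm{Dio}(T,R)$ for $x_0=\Gamma g_0$: for all $j\in\{1,\dots,n-1\}$ and all $w\in\Lambda^j(\mathbb{Z}^n)\setminus\{0\}$ there exists $u\in u([0,T]^d)$ such that $\|w\,g_0\,u\|\ge R^{q}$, where $q=d/n$. Sobolev norm: fix a basis $\mathcal{B}$ of the Lie algebra of $G$ acting by $Yf(x)=\frac{d}{dt}f(x\exp(tY))|_{t=0}$; $\mathcal{S}_{\infty,\ell}(f)=\sum_{\deg\mathcal{D}\le\ell}\|\mathcal{D}f\|_{L^\infty(X)}$ over monomials in $\mathcal{B}$ of degree at most $\ell$ (including degree $0$). Constants: $C>0$ is a fixed constant depending only on $n,d$, for which (for some $\gamma>0$ depending only on $n,d$) the effective equidistribution estimate $\left|\frac1{T^d}\int_{[0,T]^d}f(x_0u(\mathbf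 t))d\mathbf t-\int_Xf\,dm_X\right|\ll R^{-\gamma}\mathcal{S}_{\infty,\ell}(f)$ holds for all $f\in C_c^\infty(X)$ and all $x_0$ satisfying $\mathrm{Dio}(T,R)$ with $T>R>C$. $0<b<1$ is a fixed constant depending only on $n,d$ for which, for all $x_0$ satisfying $\mathrm{Dio}(T,R)$ with $T>R>C$, all $f\in C_c^\infty(X)$ and all additive characters $\psi(\mathbf t)=e^{i\mathbf a\cdot\mathbf t}$ ($\mathbf a\in\mathbb{R}^d$), $$\left|\frac1{T^d}\int_{[0,T]^d}\psi(\mathbf t)\Big(f(x_0u(\mathbf t))-\int_Xf\,dm_X\Big)d\mathbf t\right|\ll R^{-b}\mathcal{S}_{\infty,\ell}(f)$$ with implied constant depending only on $n,d$. (Such $C$ and $b$ exist.) $a\ll b'$ means $a\le c\,b'$ for a constant $c$ depending only on $n$ and $d$. *)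

(* Defs.v *)
From HB Require Import structures.
From mathcomp Require Import all_boot all_order all_algebra.
From mathcomp Require Import complex.
From mathcomp Require Import all_classical all_reals all_analysis.

Set Implicit Arguments.
Unset Strict Implicit.
Unset Printing Implicit Defensive.

Import Order.TTheory GRing.Theory Num.Theory.
Import numFieldNormedType.Exports.

Local Open Scope classical_set_scope.
Local Open Scope ring_scope.

(* Lebesgue measure on R^d, as the d-fold product of Lebesgue measure on R    *)
(* transported to d.-tuple R.                                                 *)

Section LebesgueTuple.
Context {R : realType}.
Local Notation RM := (measurableTypeR R).

Definition tuple_consp d (p : RM * d.-tuple RM) : d.+1.-tuple RM :=
  [tuple of p.1 :: p.2].

Definition tuple_uncons d (t : d.+1.-tuple RM) : RM * d.-tuple RM :=
  (thead t, [tuple of behead t]).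

Lemma tuple_consK d : cancel (@tuple_consp d) (@tuple_uncons d).
Proof.
by case=> x t; rewrite /tuple_uncons /tuple_consp theadE; congr pair; apply: val_inj.
Qed.

Lemma measurable_tuple_consp d : measurable_fun setT (@tuple_consp d).
Proof. exact: measurable_cons. Qed.

Lemma measurable_tuple_uncons d : measurable_fun setT (@tuple_uncons d).
Proof.
apply/measurable_fun_pairP; split; first exact: measurable_tnth.
exact: measurable_behead.
Qed.

Section cons_measure.
Variables (d : nat) (mu : {sigma_finite_measure set (d.-tuple RM) -> \bar R}).

Definition cons_measure : set (d.+1.-tuple RM) -> \bar R :=
  pushforward ((@lebesgue_measure R) \x mu)%E (@tuple_consp d).

Let cons_measure0 : cons_measure set0 = 0%E.
Proof. by rewrite /cons_measure /pushforward preimage_set0 measure0. Qed.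

Let cons_measure_ge0 A : (0 <= cons_measure A)%E.
Proof. by rewrite /cons_measure /pushforward; exact: measure_ge0. Qed.

Let cons_measure_sigma_additive : semi_sigma_additive cons_measure.
Proof.
move=> F mF tF mUF; rewrite /cons_measure /pushforward preimage_bigcup.
have mp A : measurable A -> measurable (@tuple_consp d @^-1` A).
  by move=> mA; rewrite -[X in measurable X]setTI; exact: measurable_tuple_consp.
apply: measure_semi_sigma_additive.
- by move=> k; exact: mp.
- apply/trivIsetP => /= i j _ _ ij; rewrite -preimage_setI.
  by move/trivIsetP : tF => /(_ _ _ _ _ ij) ->//; rewrite preimage_set0.
- by rewrite -preimage_bigcup; exact: mp.
Qed.

HB.instance Definition _ := isMeasure.Build _ _ _ cons_measure
  cons_measure0 cons_measure_ge0 cons_measure_sigma_additive.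

Let cons_measure_sigma_finite : sigma_finite setT cons_measure.
Proof.
have /sigma_finiteP[F [TF ndF Foo]] := sigma_finiteT (@lebesgue_measure R).
have /sigma_finiteP[G [TG ndG Goo]] := sigma_finiteT mu.
exists (fun k => @tuple_uncons d @^-1` (F k `*` G k)).
  apply/seteqP; split => // t _.
  have : [set: RM] (thead t) by [].
  have : [set: d.-tuple RM] [tuple of behead t] by [].
  rewrite TF TG => -[j _ Gj] [i _ Fi].
  exists (maxn i j) => //; split => /=.
  - by move: Fi; apply/subsetPset/ndF/leq_maxl.
  - by move: Gj; apply/subsetPset/ndG/leq_maxr.
move=> k; have [? ?] := Foo k; have [? ?] := Goo k; split.
  rewrite -[X in measurable X]setTI.
  by apply: measurable_tuple_uncons => //; exact: measurableX.
rewrite /cons_measure /pushforward -comp_preimage.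
rewrite (_ : _ \o _ = id); last by apply/funext => p /=; rewrite tuple_consK.
by rewrite preimage_id product_measure1E// lte_mul_pinfty// ge0_fin_numE.
Qed.

HB.instance Definition _ := Measure_isSigmaFinite.Build _ _ _ cons_measure
  cons_measure_sigma_finite.

End cons_measure.

Fixpoint lebesgue_tuple d : {sigma_finite_measure set (d.-tuple RM) -> \bar R} :=
  if d is d'.+1 then cons_measure (lebesgue_tuple d')
  else \d_([tuple] : 0.-tuple RM).

End LebesgueTuple.

Section SpecialLinear.
Context {R : realType} {n : nat}.

Definition SL_set : set 'M[R]_n := [set g | \det g = 1].

Definition SL : Type := set_type SL_set.
HB.instance Definition _ := SubType.copy SL (set_type SL_set).
HB.instance Definition _ := Choice.copy SL (set_type SL_set).
HB.instance Definition _ := Topological.copy SL (set_type SL_set).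

Definition mx_of_SL (g : SL) : 'M[R]_n := val g.
Coercion mx_of_SL : SL >-> matrix.

Definition mkSL (g : 'M[R]_n) (h : \det g = 1) : SL := SigSub (mem_set h).

Lemma det_SL (g : SL) : \det g = 1.
Proof. exact: set_mem (valP g). Qed.

Definition SL1 : SL := mkSL (det1 R n).
HB.instance Definition _ := isPointed.Build SL SL1.

Lemma det_SLM (g h : SL) : \det (g *m h) = 1.
Proof. by rewrite det_mulmx !det_SL mulr1. Qed.

Definition SLM (g h : SL) : SL := mkSL (det_SLM g h).

Lemma SLME (g h : SL) : SLM g h = g *m h :> 'M[R]_n.
Proof. by []. Qed.

Definition SLZ : set 'M[R]_n :=
  [set map_mx intr c | c in [set c : 'M[int]_n | \det c = 1]].

Definition same_coset (g h : SL) : bool :=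
  `[< exists2 c, SLZ c & h = c *m g :> 'M[R]_n >].

Lemma same_coset_refl : reflexive same_coset.
Proof.
move=> g; apply/asboolP; exists 1%:M; last by rewrite mul1mx.
by exists 1%:M; rewrite /= ?det1 ?map_mx1.
Qed.

Lemma same_coset_trans : transitive same_coset.
Proof.
move=> h g k /asboolP[_ [c cE <-] hE] /asboolP[_ [c' cE' <-] kE].
apply/asboolP; exists (map_mx intr (c' *m c)).
  by exists (c' *m c); rewrite //= det_mulmx cE cE' mulr1.
by rewrite kE hE map_mxM mulmxA.
Qed.

Lemma same_coset_sym : symmetric same_coset.
Proof.
suff H g h : same_coset g h -> same_coset h g by move=> g h; apply/idP/idP; exact: H.
move=> /asboolP[_ [c /= cE <-] hE]; apply/asboolP.
have uc : c \in unitmx by rewrite unitmxE cE unitr1.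
exists (map_mx intr (invmx c)).
  by exists (invmx c); rewrite //= det_inv cE invr1.
by rewrite hE mulmxA -map_mxM mulVmx// map_mx1 mul1mx.
Qed.

Definition coset_equiv : equiv_rel SL :=
  EquivRel same_coset same_coset_refl same_coset_sym same_coset_trans.

Definition X : Type := quotient_topology {eq_quot coset_equiv}%qT.
HB.instance Definition _ := Quotient.copy X {eq_quot coset_equiv}%qT.
HB.instance Definition _ := PointedTopological.copy X
  (quotient_topology {eq_quot coset_equiv}%qT).

Definition piX (g : SL) : X := \pi_X%qT g.

Definition borelX := g_sigma_algebraType (@open X).

Definition actX (x : X) (h : SL) : X := piX (SLM (repr x) h).

Lemma actX_pi (g h : SL) : actX (piX g) h = piX (SLM g h).
Proof.
apply/eqmodP/asboolP.
have /eqmodP/asboolP[c cZ gE] : piX (repr (piX g)) = piX g by rewrite /piX reprK.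
by exists c => //; rewrite !SLME gE mulmxA.
Qed.

Definition right_invariant (mX : probability borelX R) : Prop :=
  forall (h : SL) (A : set borelX), measurable A ->
    mX ((fun x : X => actX x h) @^-1` A) = mX A.

End SpecialLinear.
Arguments SL_set : clear implicits.
Arguments SL : clear implicits.
Arguments SLZ : clear implicits.
Arguments X : clear implicits.
Arguments borelX : clear implicits.

(* An identification of the d coordinates with the positions (i, j) of the    *)
(* upper-right m x (n - m) block.                                             *)
Record block_coord (n m d : nat) := BlockCoord {
  coord :> 'I_d -> 'I_n * 'I_n;
  coord_inj : injective coord;
  coordP : forall ij : 'I_n * 'I_n,
    (exists k, coord k = ij) <-> (ij.1 < m <= ij.2)%N }.

Section Flow.
Context {R : realType} {n m d : nat} (e : block_coord n m d).

Definition horo_mx (t : 'I_d -> R) : 'M[R]_n :=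
  1%:M + \sum_(k < d) t k *: delta_mx (e k).1 (e k).2.

Lemma det_horo_mx t : \det (horo_mx t) = 1.
Proof.
have lt k : ((e k).1 < (e k).2)%N.
  have /andP[ltm lem] : ((e k).1 < m <= (e k).2)%N by apply/coordP; exists k.
  exact: leq_trans ltm lem.
have E (i j : 'I_n) : (j <= i)%N -> horo_mx t i j = (i == j)%:R.
  move=> ji; rewrite /horo_mx mxE summxE big1 ?addr0 ?mxE// => k _.
  rewrite !mxE; case: eqP => [ik|]; last by rewrite mulr0.
  case: eqP => [jk|]; last by rewrite mulr0.
  by move: (lt k); rewrite -ik -jk ltnNge ji.
rewrite -det_tr det_trig.
  by rewrite big1// => i _; rewrite mxE E// eqxx.
apply/is_trig_mxP => i j ij; rewrite mxE E; last exact: ltnW.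
by rewrite -val_eqE gtn_eqF.
Qed.

Definition horo (t : 'I_d -> R) : SL R n := mkSL (det_horo_mx t).

End Flow.

Definition box {R : realType} {d : nat} (T : R) : set ('I_d -> R) :=
  [set t | forall i, 0 <= t i <= T].

(* Exterior powers, in the standard basis e_I indexed by the strictly         *)
(* increasing I : 'I_j -> 'I_n.                                               *)

Definition extidx (n j : nat) : Type :=
  {I : {ffun 'I_j -> 'I_n} | [forall a : 'I_j, forall b : 'I_j, (a < b)%N ==> (I a < I b)%N]}.
HB.instance Definition _ n j := Finite.copy (extidx n j)
  {I : {ffun 'I_j -> 'I_n} | _}.

Section Exterior.
Context {R : realType} {n j : nat}.

Definition extpow := {ffun extidx n j -> R}.

(* v_1 /\ ... /\ v_j for the rows v_i of v: its coordinate on e_I is the      *)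
(* minor of v on the columns I.                                               *)
Definition wedge (v : 'M[R]_(j, n)) : extpow :=
  [ffun I : extidx n j => \det (colsub (val I) v)].

Definition ext_act (w : extpow) (g : 'M[R]_n) : extpow :=
  \sum_I w I *: wedge (rowsub (val I) g).

Definition ext_norm (w : extpow) : R := \big[Num.max/0]_I `|w I|.

Definition ext_int (w : extpow) : Prop := forall I, w I \is a Num.int.

End Exterior.
Arguments extpow : clear implicits.

Definition Dio {R : realType} {n d : nat} (u : ('I_d -> R) -> SL R n)
    (T r : R) (g0 : SL R n) : Prop :=
  forall (j : nat) (w : extpow R n j), (1 <= j <= n - 1)%N ->
    ext_int w -> w != 0 ->
  exists2 t, box T t &
    r `^ (d%:R / n%:R) <= ext_norm (ext_act w (g0 *m u t)).

Section Smooth.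
Context {R : realType}.

Definition iter_derive {V : normedModType R} (s : seq V) (F : V -> R) : V -> R :=
  foldr (fun v h x => 'D_v h x) F s.

Definition smooth_on {V : normedModType R} (O : set V) (F : V -> R) : Prop :=
  forall (s : seq V) (x : V), O x ->
    {for x, continuous (iter_derive s F)} /\
    forall v, derivable (iter_derive s F) x v.

(* Smoothness on the embedded submanifold SL_n(R) of 'M[R]_n: locally the     *)
(* restriction of a smooth function on an open set of matrices.               *)
Definition smooth_SL {n : nat} (h : SL R n -> R) : Prop :=
  forall g : SL R n, exists (O : set 'M[R]_n) (F : 'M[R]_n -> R),
    [/\ open O, O g, smooth_on O F & forall g' : SL R n, O g' -> F g' = h g'].

Definition Cc_infty {n : nat} (f : X R n -> R[i]) : Prop :=
  [/\ smooth_SL (fun g => complex.Re (f (piX g))),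
      smooth_SL (fun g => complex.Im (f (piX g))) &
      compact (closure [set x | f x != 0])].

End Smooth.

Definition cintegral {R : realType} {dsp : measure_display}
    {T : measurableType dsp} (mu : {measure set T -> \bar R}) (D : set T)
    (F : T -> R[i]) : R[i] :=
  (\int[mu]_(x in D) complex.Re (F x) +i* \int[mu]_(x in D) complex.Im (F x))%C.

Definition mean_X {R : realType} {n : nat} (mX : probability (borelX R n) R)
    (f : X R n -> R[i]) : R[i] := cintegral mX setT f.

Definition box_average {R : realType} {d : nat} (T : R)
    (F : ('I_d -> R) -> R[i]) : R[i] :=
  ((T ^- d)%:C)%C * cintegral (lebesgue_tuple d)
    [set t : d.-tuple (measurableTypeR R) | box T (tnth t)]
    (fun t => F (tnth t)).

Section Sobolev.
Context {R : realType} {n : nat}.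

Definition expmx (A : 'M[R]_n) : 'M[R]_n :=
  limn (series (fun k => (k`!%:R)^-1 *: A ^+ k)).

(* For Y of trace 0 the matrix expmx Y has determinant 1, so that the default *)
(* value SL1 is not used on the Lie algebra.                                  *)
Definition expSL (Y : 'M[R]_n) : SL R n := insubd SL1 (expmx Y).

Definition slie : {vspace 'M[R]_n} := lker (linfun (mxtrace : 'M[R]_n -> R^o)).

Definition lie_derive (Y : 'M[R]_n) (f : X R n -> R[i]) (x : X R n) : R[i] :=
  (derive1 (fun t : R => complex.Re (f (actX x (expSL (t *: Y))))) 0 +i*
   derive1 (fun t : R => complex.Im (f (actX x (expSL (t *: Y))))) 0)%C.

Definition lie_monomial (s : seq 'M[R]_n) (f : X R n -> R[i]) : X R n -> R[i] :=
  foldr lie_derive f s.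

(* The sum ranges over all noncommutative monomials in the elements of B, the *)
(* empty one included.                                                        *)
Definition sobolev (mX : probability (borelX R n) R) {N : nat}
    (B : N.-tuple 'M[R]_n) (l : nat) (f : X R n -> R[i]) : \bar R :=
  (\sum_(k < l.+1) \sum_(s : k.-tuple 'I_N)
    Lnorm mX +oo (fun x => (Normc.normc (lie_monomial (map (tnth B) s) f x))%:E))%E.

End Sobolev.

Definition ell (n : nat) : nat := ((n * (n - 1)) %/ 2)%N.

(* Constants depend only on n and d: C, b, gamma and the implied constant c   *)
(* below are the same for every m and every identification of coordinates.    *)

Section Equidistribution.
Context {R : realType} {n : nat} (mX : probability (borelX R n) R).
Context {N : nat} (B : N.-tuple 'M[R]_n) (d : nat).

Definition add_char (a t : 'I_d -> R) : R[i] :=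
  (cos (\sum_(i < d) a i * t i) +i* sin (\sum_(i < d) a i * t i))%C.

Definition effective_equidistribution (C : R) : Prop :=
  exists gamma c : R, [/\ 0 < gamma, 0 < c &
    forall (m : nat) (e : block_coord n m d), (1 <= m < n)%N ->
      d = (m * (n - m))%N ->
    forall (T r : R) (g0 : SL R n) (f : X R n -> R[i]),
      Dio (horo e) T r g0 -> C < r < T -> Cc_infty f ->
      ((Normc.normc
          (box_average T (fun t => f (actX (piX g0) (horo e t))) - mean_X mX f))%:E
       <= (c * r `^ (- gamma))%:E * sobolev mX B (ell n) f)%E].

Definition twisted_equidistribution (C b : R) : Prop :=
  exists c : R, 0 < c /\
    forall (m : nat) (e : block_coord n m d), (1 <= m < n)%N ->
      d = (m * (n - m))%N ->
    forall (T r : R) (g0 : SL R n) (f : X R n -> R[i]) (a : 'I_d -> R),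
      Dio (horo e) T r g0 -> C < r < T -> Cc_infty f ->
      ((Normc.normc
          (box_average T (fun t =>
            add_char a t * (f (actX (piX g0) (horo e t)) - mean_X mX f))))%:E
       <= (c * r `^ (- b))%:E * sobolev mX B (ell n) f)%E.

End Equidistribution.

(* The diagonal matrix K = diag(K_1, ..., K_d), given by its entries.         *)

Section Diagonal.
Context {R : realType} {d : nat} (K : 'I_d -> R).

Definition detK : R := \prod_(i < d) K i.

Definition Kvec (k : {ffun 'I_d -> int}) : 'I_d -> R := fun i => K i * (k i)%:~R.

Definition maxK : R := \big[Num.max/0]_(i < d) K i.

(* The neutral value T is harmless: minK is used with K_i <= T for all i.     *)
Definition minK (T : R) : R := \big[Num.min/T]_(i < d) K i.

Definition CK (C b T : R) : R :=
  Num.max C ((2 / minK T) `^ ((d%:R + 1) / b) * detK `^ (b^-1)).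

End Diagonal.

Definition orbit_sum {R : realType} {n d : nat} (u : ('I_d -> R) -> SL R n)
    (g0 : SL R n) (K : 'I_d -> R) (T : R) (f : X R n -> R[i]) : R[i] :=
  \sum_(k \in [set k : {ffun 'I_d -> int} | box T (Kvec K k)])
    f (actX (piX g0) (u (Kvec K k))).

(* Main.v *)
Require Import Defs.
From HB Require Import structures.
From mathcomp Require Import all_boot all_order all_algebra.
From mathcomp Require Import complex.
From mathcomp Require Import all_classical all_reals all_analysis.
From mathcomp Require Import ess_sup_inf measurable_realfun.
From mathcomp Require Import ring lra zify.
Import Order.TTheory GRing.Theory Num.Theory.
Import numFieldNormedType.Exports.
Local Open Scope classical_set_scope.
Local Open Scope ring_scope.

Set Implicit Arguments.
Unset Strict Implicit.
Unset Printing Implicit Defensive.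

(** The idea is to replace the sum over the points K k by the integral of
    a smoothed comb.  For every i there is a nonnegative K_i-periodic
    trigonometric polynomial g_i of mass one per period, concentrated within
    O(delta) of the multiples of K_i, whose Fourier coefficients have l^1
    norm at most 4 / delta: the Jackson kernel, a normalised fourth power of
    the Dirichlet kernel ([jackson_kernel]).  Let G(t) be the product of the
    g_i(t_i) and let F(t) be the real or the imaginary part of
    f(x_0 u(t)) - int f.  The integral of G F over the box is estimated in two
    ways.

    - G is a combination of additive characters whose coefficients have total
      size at most (4 / delta)^d ([tensor_expansion]).  The twisted
      equidistribution estimate, applied to each of them, shows that the
      integral is O(T^d delta^-d R^-b S(f)) ([twisted_kernel]).
    - On the cell around a node K k, replacing F by F(K k) costs
      O(L delta), where L is a Lipschitz constant of F, and the cells that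
      meet the boundary of the box are a proportion O(max_i K_i / T) of all
      T^d / |K| cells.  So the integral is the sum of the F(K k) up to
      O((T^d / |K|) (L delta + (max_i K_i / T) sup |F|)) ([quadrature]).

    Together they bound the sum of the F(K k) ([node_sum_bound]).  What is
    left is int f times the difference between the number of nodes and
    T^d / |K|, again a boundary term ([prod_near]).  The two terms that
    contain delta balance when delta^(d+1) = |K| R^-b, and both then equal
    the first term of the claim ([optimal_scale]); the construction needs
    delta <= K_i for all i, which is what R > C_K ensures
    ([optimal_scale_lt]).

    Both sup |F| and L are O(S(f)).  The norm S(f) is made of essential
    suprema, but these are true suprema: the functions are continuous, and
    m_X gives positive mass to nonempty open sets because countably many
    translates of such a set cover X ([null_open_set0]).  The derivative of
    f(x_0 u(t)) along a coordinate is the Lie derivative of f along an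
    elementary nilpotent matrix, hence a fixed combination of the derivatives
    along the given basis ([orbit_lipschitz]).  Linearity of Lie derivatives
    in the direction is the chain rule for functions with continuous
    directional derivatives ([C1_chain]), and det (exp Y) = 1 for tr Y = 0
    ([det_expmx]) guarantees that the curves in the definition of the Lie
    derivative are the one-parameter subgroups.  If S(f) is infinite there is
    nothing to prove, as its factor is positive. *)

(** * Directional derivatives and the matrix exponential *)

Lemma is_derive_cvg (R : realType) (f : R -> R) (a df : R) :
  h^-1 * (f (a + h) - f a) @[h --> 0^'] --> df -> is_derive a 1 f df.
Proof.
move=> H.
have H' : h^-1 *: (f (h *: 1 + a) - f a) @[h --> 0^'] --> df.
  rewrite (_ : (fun h => _) = fun h => h^-1 * (f (a + h) - f a))//.
  by apply/funext => h; rewrite -[h%:A]/(h * 1) mulr1 [in RHS](addrC a).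
by split; [apply/cvg_ex; exists df | exact: cvg_lim].
Qed.

Lemma is_derive_cvgP (R : realType) (f : R -> R) (a df : R) :
  is_derive a 1 f df -> h^-1 * (f (a + h) - f a) @[h --> 0^'] --> df.
Proof.
move=> [/= ex <-].
have E : (fun h => h^-1 *: ((f \o shift a) (h *: (1 : R)) - f a)) =
         (fun h => h^-1 * (f (a + h) - f a)).
  by apply/funext => h /=; rewrite -[h%:A]/(h * 1) mulr1 (addrC a).
by move: ex; rewrite /derive /derivable E.
Qed.

Lemma is_derive_line (R : realType) (V : normedModType R) (F : V -> R) (y v : V) (t : R) :
  derivable F (y + t *: v) v ->
  is_derive t 1 (fun s => F (y + s *: v)) ('D_v F (y + t *: v)).
Proof.
move=> D; apply: is_derive_cvg.
under eq_fun do rewrite [t + _]addrC scalerDl addrCA.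
exact: D.
Qed.

Lemma MVT_line (R : realType) (V : normedModType R) (F : V -> R) (y v : V) (c : R) :
  (forall t : R, `|t| <= `|c| -> derivable F (y + t *: v) v) ->
  exists2 t : R, `|t| <= `|c| & F (y + c *: v) - F y = c * 'D_v F (y + t *: v).
Proof.
move=> D; set g := fun s => F (y + s *: v).
have der (t : R) : `|t| <= `|c| -> is_derive t 1 g ('D_v F (y + t *: v)).
  by move=> tc; apply: is_derive_line; exact: D.
have gE (a b : R) : a <= b -> (forall t : R, a <= t <= b -> `|t| <= `|c|) ->
    exists2 t : R, `|t| <= `|c| & g b - g a = 'D_v F (y + t *: v) * (b - a).
  move=> ab sub.
  have [||t tab ->] := @MVT_segment R g (fun t => 'D_v F (y + t *: v)) a b ab.
  - by move=> t; rewrite in_itv/= => /andP[/ltW at_ /ltW tb]; apply/der/sub; rewrite at_.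
  - apply: derivable_within_continuous => t; rewrite in_itv/= => tab.
    by have [] := der t (sub t tab).
  - by exists t => //; apply: sub; move: tab; rewrite in_itv.
have [c0|c0] := leP 0 c.
  have [t|t tc] := gE 0 c c0; first by case/andP=> t0 tc; rewrite ger0_norm// ger0_norm.
  by rewrite /g scale0r addr0 subr0 mulrC; exists t.
have [t|t tc] := gE c 0 (ltW c0).
  by case/andP=> tc t0; rewrite ler0_norm// ltr0_norm// lerN2.
rewrite /g scale0r addr0 sub0r mulrN => /eqP; rewrite -eqr_opp opprB opprK => /eqP ->.
by exists t => //; rewrite mulrC.
Qed.

Lemma cvg_sumr (K : numFieldType) (V : normedModType K) (T : Type) (G : set_system T)
    {FG : Filter G} (I : Type) (r : seq I) (f : I -> T -> V) (a : I -> V) :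
  (forall i, f i t @[t --> G] --> a i) ->
  \sum_(i <- r) f i t @[t --> G] --> \sum_(i <- r) a i.
Proof.
move=> H; apply: (@cvg_big _ _ +%R 0 xpredT _ T G r f a) => //.
exact: add_continuous.
Qed.

(** Differentiability of [F] is not assumed, only continuous directional
    derivatives.  The increments [c i t *: v i] are added one at a time; by
    the mean value theorem each of them contributes [c i t] times a directional
    derivative of [F] at a point that tends to [x]. *)
Lemma C1_chain (R : realType) (V : normedModType R) (O : set V) (F : V -> R) (x : V) :
  open O -> O x ->
  (forall v y, O y -> {for y, continuous ('D_v F)} /\ derivable F y v) ->
  forall (I : Type) (v : I -> V) (c : I -> R -> R) (dc : I -> R),
  (forall i, c i 0 = 0 /\ is_derive (0 : R) (1 : R) (c i) (dc i)) ->
  forall r : seq I,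
  is_derive (0 : R) (1 : R) (fun t => F (x + \sum_(i <- r) c i t *: v i))
    (\sum_(i <- r) dc i * 'D_(v i) F x).
Proof.
move=> oO Ox C1 I v c dc hc; elim=> [|i r IH].
  rewrite big_nil; under eq_fun do rewrite big_nil.
  exact: is_derive_cst.
have [ci0 dci] := hc i.
have cc j : {for 0, continuous (c j)}.
  have [_ [+ _]] := hc j.
  by move=> /derivable1_diffP/differentiable_continuous.
pose A t := x + \sum_(j <- r) c j t *: v j.
have A0 : A 0 = x.
  by rewrite /A big1 ?addr0// => j _; have [-> _] := hc j; rewrite scale0r.
have cA : A t @[t --> (0:R)] --> x.
  rewrite -[X in _ --> X]A0 /A; apply: cvgD; first exact: cvg_cst.
  by apply: cvg_sumr => j; apply: cvgZr_tmp; exact: cc.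
pose H t := F (A t + c i t *: v i) - F (A t).
(* xi is the difference quotient of F in the direction v i, extended by its
   limit where c i vanishes. *)
pose xi t := if c i t == 0 then 'D_(v i) F x else (c i t)^-1 * H t.
have HE t : H t = c i t * xi t.
  rewrite /xi; case: eqP => [z|/eqP nz]; last by rewrite mulVKf.
  by rewrite z mul0r /H z scale0r addr0 subrr.
have xic : xi t @[t --> (0 : R)] --> 'D_(v i) F x.
  apply/cvgrPdist_le => e e0.
  have [cD _] := C1 (v i) x Ox.
  have : \forall y \near x, O y /\ `|'D_(v i) F x - 'D_(v i) F y| <= e.
    apply: filterI; first exact: open_nbhs_nbhs.
    by move/cvgrPdist_le : cD => /(_ e e0).
  move=> /nbhs_ballP[/= rho rho0 hb].
  have [near1 near2] : (\forall t \near (0 : R), `|x - A t| < rho / 2) /\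
     (\forall t \near (0:R), `|c i t| * `|v i| < rho / 2).
    have rho2 : 0 < rho / 2 by rewrite divr_gt0.
    split; first by move/cvgrPdist_lt : cA; exact.
    have : c i t * `|v i| @[t --> (0:R)] --> 0 * `|v i|.
      by apply: cvgM; [rewrite -[X in _ --> X]ci0; exact: cc | exact: cvg_cst].
    rewrite mul0r => /cvgrPdist_lt /(_ _ rho2).
    by apply: filterS => t; rewrite sub0r normrN normrM normr_id.
  near=> t; rewrite /xi; case: eqP => [_|/eqP nz]; first by rewrite subrr normr0 ltW.
  have inb s : `|s| <= `|c i t| -> ball x rho (A t + s *: v i).
    move=> sc; rewrite -ball_normE /ball_ /= opprD addrA.
    apply: (le_lt_trans (ler_normB _ _)).
    rewrite [ltRHS](splitr rho); apply: ltrD; first by near: t.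
    rewrite normrZ; apply: (@le_lt_trans _ _ (`|c i t| * `|v i|)); last by near: t.
    by rewrite ler_wpM2r.
  have [s sc E] := @MVT_line R V F (A t) (v i) (c i t)
    (fun s sc => (C1 (v i) _ (hb _ (inb s sc)).1).2).
  rewrite /H E mulKf//.
  exact: (hb _ (inb s sc)).2.
have DH : is_derive (0 : R) (1 : R) H (dc i * 'D_(v i) F x).
  apply: is_derive_cvg.
  have H0 : H 0 = 0 by rewrite HE ci0 mul0r.
  under eq_fun do rewrite add0r H0 subr0 HE mulrA.
  apply: cvgM; last by apply: cvg_within_filter.
  have := is_derive_cvgP dci.
  by under eq_fun do rewrite add0r ci0 subr0.
rewrite big_cons.
have -> : (fun t => F (x + \sum_(j <- (i :: r)) c j t *: v j)) = H + (fun t => F (A t)).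
  apply/funext => t; rewrite /H /A big_cons [in RHS]/= -[RHS]/(_ - _ + _) subrK.
  by rewrite [_ *: v i + _]addrC addrA.
exact: is_deriveD.
Unshelve. all: by end_near.
Qed.
Lemma cvg_mx (R : realType) (T : Type) (G : set_system T) {FG : Filter G} (m n : nat)
    (f : T -> 'M[R]_(m, n)) (M : 'M[R]_(m, n)) :
  (forall i j, f t i j @[t --> G] --> M i j) -> f t @[t --> G] --> M.
Proof.
move=> H; rewrite (matrix_sum_delta M).
rewrite (_ : f = fun t => \sum_(i < m) \sum_(j < n) f t i j *: delta_mx i j); last first.
  by apply/funext => t; rewrite -matrix_sum_delta.
apply: cvg_sumr => i; apply: cvg_sumr => j.
by apply: cvgZr_tmp; exact: H.
Qed.

Lemma cvg_mxP (R : realType) (T : Type) (G : set_system T) {FG : Filter G} (m n : nat)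
    (f : T -> 'M[R]_(m, n)) (M : 'M[R]_(m, n)) i j :
  f t @[t --> G] --> M -> f t i j @[t --> G] --> M i j.
Proof.
by apply: (@continuous_cvg _ _ _ G FG f (fun N : 'M[R]_(m, n) => N i j)); exact: coord_continuous.
Qed.

Lemma cvg_det (R : realType) (T : Type) (G : set_system T) {FG : Filter G} (n : nat)
    (f : T -> 'M[R]_n) (M : 'M[R]_n) :
  f t @[t --> G] --> M -> \det (f t) @[t --> G] --> \det M.
Proof.
move=> fM; rewrite /determinant.
apply: cvg_sumr => s; apply: cvgM; first exact: cvg_cst.
apply: (@cvg_big R _ (@GRing.mul R) 1 xpredT _ T G _
  (fun i t => f t i (perm.fun_of_perm s i)) (fun i => M i (perm.fun_of_perm s i))) => [|i _].
  exact: mul_continuous.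
exact: cvg_mxP.
Qed.

Lemma mx_exprZ (R : realType) (n : nat) (t : R) (A : 'M[R]_n) k :
  (t *: A) ^+ k = t ^+ k *: A ^+ k.
Proof.
elim: k => [|k IH]; first by rewrite !expr0 scale1r.
by rewrite !exprS IH -[LHS]/(_ *m _) -scalemxAl -scalemxAr scalerA.
Qed.

(** Dominates all the entries and is submultiplicative, so that it reduces
    the convergence of matrix series to that of real ones. *)
Definition mx_l1 (R : realType) (n : nat) (A : 'M[R]_n) : R :=
  \sum_i \sum_j `|A i j|.

Lemma mx_l1_ge0 (R : realType) (n : nat) (A : 'M[R]_n) : 0 <= mx_l1 A.
Proof. by apply: sumr_ge0 => i _; apply: sumr_ge0. Qed.

Lemma normr_mxX_le (R : realType) (n : nat) (A : 'M[R]_n) k i j :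
  `|(A ^+ k) i j| <= mx_l1 A ^+ k.
Proof.
elim: k i j => [|k IH] i j.
  by rewrite !expr0 mxE; case: eqP; rewrite ?normr1 ?normr0.
rewrite exprS mxE (le_trans (ler_norm_sum _ _ _))// exprS.
apply: (@le_trans _ _ (\sum_j0 `|A i j0| * mx_l1 A ^+ k)).
  by apply: ler_sum => l _; rewrite normrM ler_wpM2l.
rewrite -mulr_suml ler_wpM2r ?exprn_ge0 ?mx_l1_ge0//.
rewrite /mx_l1 [leRHS](bigD1 i)//= lerDl.
by apply: sumr_ge0 => i' _; apply: sumr_ge0.
Qed.

Definition expmx_series (R : realType) (n : nat) (A : 'M[R]_n) (N : nat) : 'M[R]_n :=
  series (fun k => (k`!%:R)^-1 *: A ^+ k) N.

Lemma expmx_seriesE (R : realType) (n : nat) (A : 'M[R]_n) N i j :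
  expmx_series A N i j = series (fun k => (k`!%:R)^-1 * (A ^+ k) i j) N.
Proof. by rewrite /expmx_series /series/= summxE; apply: eq_bigr => k _; rewrite mxE. Qed.

Lemma cvg_expmx (R : realType) (n : nat) (A : 'M[R]_n) :
  expmx_series A N @[N --> \oo] --> expmx A.
Proof.
have H i j : cvgn (series (fun k => (k`!%:R)^-1 * (A ^+ k) i j)).
  apply: normed_cvg.
  apply: (@series_le_cvg _ _ (exp_coeff (mx_l1 A))).
  - by move=> k /=.
  - by move=> k; apply: exp_coeff_ge0; exact: mx_l1_ge0.
  - move=> k /=; rewrite normrM ger0_norm ?invr_ge0// /exp_coeff/= mulrC.
    by rewrite ler_wpM2r ?invr_ge0// normr_mxX_le.
  - exact: is_cvg_series_exp_coeff.
have C : cvgn (expmx_series A).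
  apply/cvg_ex; exists (\matrix_(i, j) limn (series (fun k => (k`!%:R)^-1 * (A ^+ k) i j))).
  apply: cvg_mx => i j; rewrite mxE.
  by under eq_fun do rewrite expmx_seriesE; exact: H.
exact: C.
Qed.

Lemma series_exp_le (R : realType) (a : R) N : 0 <= a -> series (exp_coeff a) N <= expR a.
Proof.
move=> a0; apply: nondecreasing_cvgn_le; last exact: is_cvg_series_exp_coeff.
by apply: nondecreasing_series => k _ _; exact: exp_coeff_ge0.
Qed.

(** The terms of order at least 2 of the exponential series carry a factor
    [t ^+ 2], and the remaining series is dominated by that of the real
    exponential at [mx_l1 Y]. *)
Lemma expmx_entry_bound (R : realType) (n : nat) (Y : 'M[R]_n) (t : R) i j :
  `|t| <= 1 ->
  `|expmx (t *: Y) i j - (1%:M : 'M[R]_n) i j - t * Y i j| <= t ^+ 2 * expR (mx_l1 Y).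
Proof.
move=> t1.
have C : expmx_series (t *: Y) N i j - (1%:M : 'M[R]_n) i j - t * Y i j
    @[N --> \oo] --> expmx (t *: Y) i j - (1%:M : 'M[R]_n) i j - t * Y i j.
  by apply: cvgB; [apply: cvgB; [apply: cvg_mxP; exact: cvg_expmx | exact: cvg_cst]
    | exact: cvg_cst].
move: C => /cvg_norm; rewrite -(cvg_shiftn 2) => /= C.
apply: (cvgr_to_le C).
apply: nearW => N.
rewrite expmx_seriesE /series/= addn2 big_nat_recl// big_nat_recl//= !expr0 expr1 !invr1 !mul1r.
rewrite [(t *: Y) i j]mxE.
have cancel3 (x y z : R) : x + (y + z) - x - y = z by ring.
rewrite cancel3.
rewrite (le_trans (ler_norm_sum _ _ _))//.
apply: (@le_trans _ _ (\sum_(0 <= k < N) t ^+ 2 * exp_coeff (mx_l1 Y) k.+2)).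
  apply: ler_sum => k _; rewrite mx_exprZ mxE normrM ger0_norm ?invr_ge0//.
  rewrite /exp_coeff/= normrM mulrC mulrA ler_wpM2r ?invr_ge0//.
  apply: ler_pM => //; last exact: normr_mxX_le.
  rewrite normrX -addn2 addnC exprD real_normK ?num_real//.
  by rewrite ler_piMr ?sqr_ge0// exprn_ile1.
rewrite -mulr_sumr ler_wpM2l ?sqr_ge0//.
apply: le_trans (series_exp_le N.+2 (mx_l1_ge0 Y)).
rewrite /series/= [leRHS]big_nat_recl// [X in _ <= _ + X]big_nat_recl//.
by rewrite addrA lerDr addr_ge0// exp_coeff_ge0// mx_l1_ge0.
Qed.

(** With [h != 0] the determinant is [h ^+ n] times the characteristic
    polynomial of [- A] at [h^-1], hence a polynomial in [h] whose constant
    term is 1 and whose coefficient of degree one is the trace. *)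
Lemma det_1DZ (R : realType) (n : nat) (A : 'M[R]_n) : \tr A = 0 ->
  exists2 c : R, 0 <= c & forall h : R, `|h| <= 1 -> `|\det (1%:M + h *: A) - 1| <= c * h ^+ 2.
Proof.
case: n A => [|n] A tr0.
  by exists 0 => // h _; rewrite det_mx00 subrr normr0 mul0r.
pose p := char_poly (- A).
exists (\sum_(k < n) `|p`_k|) => [|h h1]; first by apply: sumr_ge0.
have [->|h0] := eqVneq h 0.
  by rewrite scale0r addr0 det1 subrr normr0 expr0n mulr0.
have -> : \det (1%:M + h *: A) = h ^+ n.+1 * p.[h^-1].
  rewrite /p /char_poly -horner_evalE -det_map_mx -detZ; congr determinant.
  apply/matrixP => i j; rewrite !mxE /= /horner_eval hornerD hornerN hornerMn hornerX hornerC.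
  by rewrite opprK mulrDr mulrnAr mulfV.
have sp : size p = n.+2 by rewrite size_char_poly.
rewrite horner_coef sp big_ord_recr/= big_ord_recr/=.
have -> : p`_n = 0.
  by rewrite /p -[n]/(n.+1.-1) char_poly_trace// raddfN /= tr0 !oppr0.
have -> : p`_n.+1 = 1.
  by have := char_poly_monic (- A); rewrite monicE lead_coefE -/p sp => /eqP.
rewrite mul0r addr0 mul1r mulrDr -exprMn mulfV// expr1n addrK mulr_sumr.
rewrite (le_trans (ler_norm_sum _ _ _))// mulr_suml; apply: ler_sum => k _.
rewrite mulrCA normrM ler_wpM2l//.
have -> : n.+1 = (k + (n - k).+1)%N by rewrite addnS subnKC// ltnW.
rewrite exprD mulrAC -exprMn mulfV// expr1n mul1r.
have -> : (n - k).+1 = (2 + (n - k.+1))%N by have := ltn_ord k; lia.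
rewrite exprD normrM ger0_norm ?sqr_ge0// ler_piMr ?sqr_ge0//.
by rewrite normrX exprn_ile1.
Qed.

Lemma norm_exprB1 (R : realType) (x e : R) N :
  `|x - 1| <= e -> `|x ^+ N - 1| <= (1 + e) ^+ N - 1.
Proof.
move=> xe; have e0 : 0 <= e := le_trans (normr_ge0 _) xe.
have x1 : `|x| <= 1 + e.
  rewrite -[x](subrK 1) addrC (le_trans (ler_normD _ _))// normr1 lerD2l//.
elim: N => [|N IH]; first by rewrite !expr0 subrr normr0.
have -> : x ^+ N.+1 - 1 = x * (x ^+ N - 1) + (x - 1).
  by rewrite exprS mulrBr mulr1 addrA subrK.
rewrite (le_trans (ler_normD _ _))// normrM.
have -> : (1 + e) ^+ N.+1 - 1 = (1 + e) * ((1 + e) ^+ N - 1) + e by rewrite exprS; ring.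
by apply: lerD => //; apply: ler_pM.
Qed.

(** From [expR x * (1 - x ^+ 2) <= 1 + x] at [x = a / N], raised to the power
    [N], and Bernoulli's inequality. *)
Lemma expR_le_1Ddiv (R : realType) (a : R) (N : nat) : 0 <= a -> a <= N.+1%:R ->
  expR a * (1 - a ^+ 2 / N.+1%:R) <= (1 + a / N.+1%:R) ^+ N.+1.
Proof.
move=> a0 aN; set x := a / N.+1%:R.
have x0 : 0 <= x by rewrite divr_ge0.
have x1 : x <= 1 by rewrite ler_pdivrMr// mul1r.
have -> : expR a = expR x ^+ N.+1 by rewrite -expRM_natl /x mulrC divfK.
have B y M : y <= 1 -> 1 - M%:R * y <= (1 - y) ^+ M :> R.
  move=> y1; elim: M => [|M IH]; first by rewrite mul0r subr0 expr0.
  rewrite exprS; apply: (@le_trans _ _ ((1 - y) * (1 - M%:R * y))).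
    rewrite -subr_ge0 -[M.+1%:R]natr1.
    have -> : (1 - y) * (1 - M%:R * y) - (1 - (M%:R + 1) * y) = M%:R * y ^+ 2 by ring.
    by rewrite mulr_ge0// sqr_ge0.
  by rewrite ler_wpM2l// subr_ge0.
have -> : 1 - a ^+ 2 / N.+1%:R = 1 - N.+1%:R * x ^+ 2.
  have E (y : R) : y != 0 -> 1 - a ^+ 2 / y = 1 - y * (a / y) ^+ 2 by move=> y0; field.
  by apply: E; rewrite pnatr_eq0.
apply: (@le_trans _ _ (expR x ^+ N.+1 * (1 - x ^+ 2) ^+ N.+1)).
  by rewrite ler_wpM2l ?exprn_ge0 ?expR_ge0// B// expr_le1.
have x2 : 0 <= 1 - x ^+ 2 by rewrite subr_ge0 expr_le1.
rewrite -exprMn lerXn2r ?nnegrE ?(mulr_ge0 (expR_ge0 _) x2) ?(addr_ge0 ler01 x0)//.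
have -> : 1 - x ^+ 2 = (1 + - x) * (1 + x) by ring.
rewrite mulrA -[leRHS]mul1r ler_wpM2r ?addr_ge0//.
rewrite -[leRHS](expRxMexpNx_1 x) ler_wpM2l ?expR_ge0//; exact: expR_ge1Dx.
Qed.

(** Euler's product is used because its determinant can be computed.  By the
    binomial formula the coefficients of [A ^+ k] in the product are at most
    those of the exponential series, so the entrywise difference is bounded by
    the same difference for the real number [mx_l1 A], which [expR_le_1Ddiv]
    controls. *)
Lemma expmx_euler (R : realType) (n : nat) (A : 'M[R]_n) :
  (1%:M + (N.+1%:R)^-1 *: A) ^+ N.+1 @[N --> \oo] --> expmx A.
Proof.
apply: cvg_mx => i j.
have C : expmx_series A N.+2 i j @[N --> \oo] --> expmx A i j.
  apply: cvg_mxP; have := @cvg_expmx R n A; rewrite -(cvg_shiftn 2) => /=.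
  by under eq_fun do rewrite addn2.
set a := mx_l1 A; have a0 : 0 <= a := mx_l1_ge0 A.
have D : \forall N \near \oo,
   `|expmx_series A N.+2 i j - ((1%:M + (N.+1%:R)^-1 *: A) ^+ N.+1) i j|
     <= expR a * a ^+ 2 * harmonic N.
  near=> N.
  have -> : ((1%:M + (N.+1%:R)^-1 *: A) ^+ N.+1) i j =
     \sum_(k < N.+2) (N.+1%:R ^- k * 'C(N.+1, k)%:R) * (A ^+ k) i j.
    rewrite addrC exprD1n summxE; apply: eq_bigr => k _.
    by rewrite mulmxnE mx_exprZ mxE exprVn -[LHS]mulr_natr mulrAC.
  rewrite expmx_seriesE /series/= big_mkord -sumrB.
  have fac (k : 'I_N.+2) : N.+1%:R ^- k * 'C(N.+1, k)%:R <= (k`!%:R)^-1 :> R.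
    rewrite mulrC ler_pdivrMr ?exprn_gt0// mulrC ler_pdivlMr ?ltr0n ?fact_gt0//.
    rewrite -natrM -natrX ler_nat bin_ffact.
    elim: (nat_of_ord k) => [|l IH]; first by rewrite ffactn0 expn0.
    by rewrite ffactnSr expnSr leq_mul// leq_subr.
  apply: (le_trans (ler_norm_sum _ _ _)).
  apply: (@le_trans _ _ (\sum_(k < N.+2) ((k`!%:R)^-1 - N.+1%:R ^- k * 'C(N.+1, k)%:R) * a ^+ k)).
    apply: ler_sum => k _; rewrite -mulrBl normrM ger0_norm ?subr_ge0//.
    by apply: ler_wpM2l; rewrite ?subr_ge0// normr_mxX_le.
  under eq_bigr do rewrite mulrBl.
  rewrite sumrB.
  have -> : \sum_(k < N.+2) N.+1%:R ^- k * 'C(N.+1, k)%:R * a ^+ k = (1 + a / N.+1%:R) ^+ N.+1.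
    rewrite [1 + _]addrC exprD1n; apply: eq_bigr => k _.
    by rewrite -mulr_natr expr_div_n; ring.
  have -> : \sum_(k < N.+2) (k`!%:R)^-1 * a ^+ k = series (exp_coeff a) N.+2.
    by rewrite /series/= big_mkord; apply: eq_bigr => k _; rewrite /exp_coeff/= mulrC.
  have aN : a <= N.+1%:R.
    apply: (@le_trans _ _ N%:R); last by rewrite ler_nat.
    by near: N; exact: nbhs_infty_ger.
  have := expR_le_1Ddiv a0 aN; have := series_exp_le N.+2 a0.
  rewrite /harmonic/= mulrBr mulr1 mulrA => lo up.
  by rewrite lerBlDr (le_trans lo)// addrC -lerBlDr.
have Z : expR a * a ^+ 2 * harmonic N @[N --> \oo] --> (0 : R).
  by rewrite -[X in _ --> X](mulr0 (expR a * a ^+ 2));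
    apply: cvgM; [exact: cvg_cst|exact: cvg_harmonic].
have E : expmx_series A N.+2 i j - ((1%:M + (N.+1%:R)^-1 *: A) ^+ N.+1) i j @[N --> \oo] --> (0:R).
  apply/norm_cvg0P; apply: (squeeze_cvgr _ (cvg_cst 0) Z).
  by near=> N; rewrite normr_ge0/=; near: N.
rewrite -[X in _ --> X]subr0.
rewrite (_ : (fun N => _) = fun N => expmx_series A N.+2 i j -
  (expmx_series A N.+2 i j - ((1%:M + (N.+1%:R)^-1 *: A) ^+ N.+1) i j)); last first.
  by apply/funext => N; rewrite subKr.
exact: cvgB.
Unshelve. all: by end_near.
Qed.

(** By [det_1DZ] the determinant of [1 + A / N] is [1 + O(1 / N ^ 2)], so its
    [N]-th power tends to 1. *)
Lemma det_expmx (R : realType) (n : nat) (A : 'M[R]_n) : \tr A = 0 -> \det (expmx A) = 1.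
Proof.
move=> /det_1DZ[c c0 H].
have C := @cvg_det _ _ _ eventually_filter _ _ _ (@expmx_euler R n A).
have D : \det ((1%:M + (N.+1%:R)^-1 *: A) ^+ N.+1) @[N --> \oo] --> (1 : R).
  have E : expR (c * harmonic N) - 1 @[N --> \oo] --> (0 : R).
    rewrite -[X in _ --> X](subrr 1); apply: cvgB; last exact: cvg_cst.
    rewrite -[X in _ --> X]expR0; apply: continuous_cvg; first exact: continuous_expR.
    by rewrite -[X in _ --> X](mulr0 c); apply: cvgM; [exact: cvg_cst|exact: cvg_harmonic].
  suff E' : \det ((1%:M + (N.+1%:R)^-1 *: A) ^+ N.+1) - 1 @[N --> \oo] --> (0 : R).
    rewrite -[X in _ --> X]add0r.
    rewrite (_ : (fun N => _) = fun N => \det ((1%:M + (N.+1%:R)^-1 *: A) ^+ N.+1) - 1 + 1).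
      by apply: cvgD E' _; exact: cvg_cst.
    by apply/funext => N; rewrite subrK.
  apply/norm_cvg0P; apply: (squeeze_cvgr _ (cvg_cst 0) E).
  apply: nearW => N; rewrite normr_ge0/=.
  have -> : \det ((1%:M + N.+1%:R^-1 *: A) ^+ N.+1) = \det (1%:M + N.+1%:R^-1 *: A) ^+ N.+1.
    elim: {2 4}N.+1 => [|k IH]; first by rewrite !expr0 det1.
    by rewrite !exprS -IH -det_mulmx.
  have h1 : `|N.+1%:R^-1 : R| <= 1 by rewrite ger0_norm ?invr_ge0// invf_le1 ?ltr0n// ler1n.
  apply: (le_trans (norm_exprB1 N.+1 (H _ h1))).
  rewrite lerD2r /harmonic/=.
  have G (y : R) : y != 0 -> c / y = y * (c * y^-1 ^+ 2) by move=> y0; field.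
  rewrite G ?pnatr_eq0//.
  rewrite expRM_natl lerXn2r ?nnegrE ?expR_ge0 ?addr_ge0 ?mulr_ge0 ?sqr_ge0//.
  exact: expR_ge1Dx.
by rewrite -(cvg_lim _ D)// -(cvg_lim _ C).
Qed.

Lemma expmx_scale0 (R : realType) (n : nat) (Y : 'M[R]_n) : expmx (0 *: Y) = 1%:M.
Proof.
apply/matrixP => i j.
have := @expmx_entry_bound R n Y 0 i j; rewrite normr0 ler01 => /(_ isT).
by rewrite expr0n/= !mul0r subr0 normr_le0 subr_eq0 => /eqP.
Qed.

Lemma is_derive_expmx (R : realType) (n : nat) (Y : 'M[R]_n) i j :
  is_derive (0 : R) (1 : R) (fun t => expmx (t *: Y) i j) (Y i j).
Proof.
apply: is_derive_cvg; rewrite expmx_scale0.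
apply/cvgrPdist_le => e e0; near=> t.
have t0 : t != 0 by near: t; exact: nbhs_dnbhs_neq.
have t1 : `|t| <= 1.
  by near: t; apply: dnbhs0_le.
rewrite add0r -(mulKf t0 (Y i j)) -mulrBr normrM normfV ler_pdivrMl ?normr_gt0//.
rewrite distrC (le_trans (expmx_entry_bound Y i j t1))//.
rewrite -real_normK ?num_real// expr2 -mulrA ler_wpM2l//.
rewrite -ler_pdivlMr ?expR_gt0//.
by near: t; apply: dnbhs0_le; rewrite divr_gt0 ?expR_gt0.
Unshelve. all: by end_near.
Qed.

(** * Topology of SL_n(R) and of its quotient *)

Lemma SL_inj (R : realType) (n : nat) (g h : SL R n) : (g : 'M[R]_n) = h -> g = h.
Proof. exact: val_inj. Qed.

Lemma mx_of_SL_continuous (R : realType) (n : nat) : continuous (@mx_of_SL R n).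
Proof. exact: initial_continuous. Qed.

(** The topology of [SL R n] is induced by the entrywise one of matrices. *)
Lemma open_SL_ball (R : realType) (n : nat) (W : set (SL R n)) (g : SL R n) :
  open W -> W g -> exists2 e : R, 0 < e &
    forall h : SL R n, (forall i j, `|h i j - g i j| < e) -> W h.
Proof.
move=> [V oV <-] Vg.
have /nbhs_ballP[e /= e0 he] : nbhs (mx_of_SL g) V by exact: open_nbhs_nbhs.
exists e => // h hg; apply: he; split=> // i j.
by rewrite /ball /= distrC; exact: hg.
Qed.

Lemma SL_continuous (R : realType) (n : nat) (T : topologicalType) (c : T -> SL R n) :
  continuous (mx_of_SL \o c) -> continuous c.
Proof.
move=> /continuousP H; apply/continuousP => _ [V oV <-].
exact: H.
Qed.

Lemma SLM_continuous (R : realType) (n : nat) (g : SL R n) : continuous (SLM g).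
Proof.
apply: SL_continuous => h; apply: (@cvg_mx _ _ (nbhs h) _) => i j /=.
rewrite mxE; under eq_fun do rewrite mxE.
apply: cvg_sumr => k; apply: cvgM; first exact: cvg_cst.
apply: cvg_mxP; exact: mx_of_SL_continuous.
Qed.

Lemma SLM_continuousl (R : realType) (n : nat) (h : SL R n) : continuous (SLM^~ h).
Proof.
apply: SL_continuous => g; apply: (@cvg_mx _ _ (nbhs g) _) => i j /=.
rewrite mxE; under eq_fun do rewrite mxE.
apply: cvg_sumr => k; apply: cvgM; last exact: cvg_cst.
apply: cvg_mxP; exact: mx_of_SL_continuous.
Qed.

Lemma piX_continuous (R : realType) (n : nat) : continuous (@piX R n).
Proof. exact: pi_continuous. Qed.

Lemma continuous_X (R : realType) (n : nat) (Z : topologicalType) (f : X R n -> Z) :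
  continuous (f \o @piX R n) -> continuous f.
Proof. by move=> H; apply/quotient_continuous. Qed.

Lemma piXP (R : realType) (n : nat) (x : X R n) : exists g, x = piX g.
Proof. by exists (repr x); rewrite /piX reprK. Qed.

(** For every rational matrix [q] and every [k], a point of [SL R n] within
    [1 / (k + 1)] of [q] is chosen if there is one; this avoids showing that
    rational points are dense. *)
Lemma SL_countable_dense (R : realType) (n : nat) :
  exists s : 'M[rat]_n * nat -> SL R n,
    forall W : set (SL R n), open W -> W !=set0 -> exists i, W (s i).
Proof.
pose P (qk : 'M[rat]_n * nat) : set (SL R n) :=
  [set g | forall i j, `|g i j - ratr (qk.1 i j)| < qk.2.+1%:R^-1].
exists (fun qk => xget SL1 (P qk)) => W oW [g Wg].
have [e e0 he] := open_SL_ball oW Wg.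
have [k ke] : exists k, k.+1%:R^-1 < e / 2.
  have e2 : 0 < e / 2 by rewrite divr_gt0.
  have := @cvg_harmonic R => /cvgrPdist_lt /(_ _ e2) [k _ /(_ k (leqnn _))] /=.
  by rewrite sub0r normrN ger0_norm ?invr_ge0// => ?; exists k.
have /(_ _ _)/cid hq i j : exists q : rat, `|g i j - ratr q| < k.+1%:R^-1.
  have k0 : 0 < k.+1%:R^-1 :> R by rewrite invr_gt0.
  have [q] := @rat_in_itvoo R (g i j - k.+1%:R^-1) (g i j + k.+1%:R^-1)
    ltac:(by rewrite ltrBlDr -addrA ltrDl addr_gt0).
  rewrite in_itv/= => /andP[q1 q2]; exists q.
  by rewrite ltr_distlC q1 q2.
exists (\matrix_(i, j) projT1 (hq i j), k).
have : P (\matrix_(i, j) projT1 (hq i j), k) g.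
  by move=> i j /=; rewrite mxE; exact: (projT2 (hq i j)).
move=> /(@xgetI _ SL1) Ph; apply: he => i j.
have := Ph i j; rewrite /= mxE; have := projT2 (hq i j).
move=> /= ya xa.
rewrite (le_lt_trans (ler_distD (ratr (sval (hq i j))) _ _))// (splitr e) ltrD//.
  exact: lt_trans ke.
by rewrite distrC; exact: lt_trans ke.
Qed.

Lemma open_measurable_X (R : realType) (n : nat) (U : set (X R n)) :
  open U -> measurable (U : set (borelX R n)).
Proof. by move=> oU; apply: sub_sigma_algebra. Qed.

(** If [U] is nonempty, the translates of [U] by a countable dense set of group
    elements cover [X], since each [x] can be moved into [U] by an open nonempty
    set of group elements.  Translates have the same mass, so [U] cannot be
    null. *)
Lemma null_open_set0 (R : realType) (n : nat) (mX : probability (borelX R n) R) :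
  right_invariant mX -> forall U : set (X R n), open U -> mX U = 0%E -> U = set0.
Proof.
move=> inv U oU mU; apply: contrapT => /eqP/set0P[y Uy].
have [s hs] := SL_countable_dense R n.
pose A k : set (borelX R n) :=
  if unpickle k is Some i then (fun x => actX x (s i)) @^-1` U else set0.
have cov : [set: borelX R n] `<=` \bigcup_k A k.
  move=> x _; have [g ->] := piXP x; have [gy yE] := piXP y.
  have [||i] := hs (SLM g @^-1` (@piX R n @^-1` U)).
  - move/continuousP: (@SLM_continuous R n g); apply.
    by move/continuousP: (@piX_continuous R n); apply.
  - have dg : \det (invmx g *m gy : 'M[R]_n) = 1.
      by rewrite det_mulmx det_inv !det_SL invr1 mulr1.
    exists (mkSL dg) => /=.
    have -> : SLM g (mkSL dg) = gy; last by rewrite -yE.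
    apply: SL_inj; rewrite SLME /= mulKVmx// unitmxE det_SL unitr1.
    by [].
  - move=> Wi; exists (pickle i) => //.
    by rewrite /A pickleK /= actX_pi.
have mpre h : measurable ((fun x => actX x h) @^-1` U : set (borelX R n)).
  apply: open_measurable_X.
  suff /continuousP : continuous (fun x : X R n => actX x h) by apply.
  apply: continuous_X.
  rewrite (_ : _ \o _ = @piX R n \o SLM^~ h); last first.
    by apply/funext => g /=; rewrite actX_pi.
  move=> g; apply: continuous_comp; [exact: SLM_continuousl|exact: piX_continuous].
have : mX.-negligible [set: borelX R n].
  apply: (negligibleS cov); apply: negligible_bigcup => k; rewrite /A.
  case: unpickle => [i|]; last exact: negligible_set0.
  apply/(negligibleP mX (mpre _)).
  exact: (etrans (inv (s i) U (open_measurable_X oU)) mU).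
move=> /(negligibleP mX measurableT) m0.
have := @probability_setT _ _ _ mX.
by move/(etrans (esym m0))/eqP; rewrite eqe eq_sym oner_eq0.
Qed.

Lemma ae_le_everywhere (R : realType) (n : nat) (mX : probability (borelX R n) R) :
  right_invariant mX -> forall (h : X R n -> R) (M : R), continuous h ->
  (\forall x \ae mX, `|h x| <= M) -> forall x, `|h x| <= M.
Proof.
move=> inv h M ch hae.
pose U := h @^-1` [set y | M < `|y|].
have oU : open U.
  move/continuousP : ch; apply.
  have /continuousP : continuous (fun y : R => `|y|) by move=> y; exact: norm_continuous.
  by move=> /(_ [set y | M < y] (@open_gt _ _)).
have mU : mX U = 0%E.
  apply/(negligibleP mX (open_measurable_X oU)).
  by apply: negligibleS hae => x /=; rewrite /U /= => Mh; rewrite leNgt Mh.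
have U0 := null_open_set0 inv oU mU.
move=> x; rewrite leNgt; apply/negP => Mh.
by have : U x by []; rewrite U0.
Qed.

(** * Lie derivatives and the Lipschitz bound along horospherical orbits *)

Lemma smooth_on_C1 (R : realType) (V : normedModType R) (O : set V) (F : V -> R) :
  smooth_on O F ->
  forall v y, O y -> {for y, continuous ('D_v F)} /\ derivable F y v.
Proof.
by move=> sF v y Oy; split; [have [] := sF [:: v] y Oy|have [_] := sF [::] y Oy].
Qed.

(** The differential of [F] at [g] as a linear form in [V]; it is defined from
    the partial derivatives to make the linearity evident. *)
Definition mx_diff (R : realType) (n : nat) (F : 'M[R]_n -> R) (g V : 'M[R]_n) : R :=
  \sum_(ij : 'I_n * 'I_n) V ij.1 ij.2 * 'D_(delta_mx ij.1 ij.2) F g.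

Lemma mx_diff_sum (R : realType) (n : nat) (F : 'M[R]_n -> R) (g : 'M[R]_n)
    (I : Type) (r : seq I) (c : I -> R) (V : I -> 'M[R]_n) :
  mx_diff F g (\sum_(k <- r) c k *: V k) = \sum_(k <- r) c k * mx_diff F g (V k).
Proof.
under [RHS]eq_bigr do rewrite /mx_diff mulr_sumr.
rewrite exchange_big/=; apply: eq_bigr => ij _.
rewrite summxE mulr_suml; apply: eq_bigr => k _.
by rewrite mxE mulrA.
Qed.

Lemma is_derive_curve (R : realType) (n : nat) (O : set 'M[R]_n) (F : 'M[R]_n -> R)
    (c : R -> 'M[R]_n) (V : 'M[R]_n) :
  open O -> O (c 0) -> smooth_on O F ->
  (forall i j, is_derive (0 : R) (1 : R) (fun t => c t i j) (V i j)) ->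
  is_derive (0 : R) (1 : R) (F \o c) (mx_diff F (c 0) V).
Proof.
move=> oO Oc /smooth_on_C1 C1 dc.
have := @C1_chain R _ O F (c 0) oO Oc C1 ('I_n * 'I_n)%type
  (fun ij => delta_mx ij.1 ij.2) (fun ij t => c t ij.1 ij.2 - c 0 ij.1 ij.2)
  (fun ij => V ij.1 ij.2) _ (index_enum _).
rewrite (_ : (fun t => F _) = F \o c); last first.
  apply/funext => t /=; congr F.
  rewrite -(pair_bigA _ (fun i j => (c t i j - c 0 i j) *: delta_mx i j))/=.
  rewrite -[RHS](subrK (c 0)) addrC [in RHS](matrix_sum_delta (c t - c 0)).
  by congr (_ + _); apply: eq_bigr => i _; apply: eq_bigr => j _; rewrite !mxE.
apply => -[i j]; split => /=; first by rewrite subrr.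
have := is_deriveB (dc i j) (is_derive_cst (c 0 i j) (0 : R) (1 : R)).
by rewrite subr0; exact.
Qed.

Lemma near_SL (R : realType) (n : nat) (O : set 'M[R]_n) (c : R -> SL R n) (V : 'M[R]_n) :
  open O -> O (c 0) ->
  (forall i j, is_derive (0 : R) (1 : R) (fun t => c t i j) (V i j)) ->
  \forall t \near (0 : R), O (c t).
Proof.
move=> oO Oc dc.
have : (fun t => c t : 'M[R]_n) t @[t --> (0:R)] --> (c 0 : 'M[R]_n).
  apply: (@cvg_mx _ _ (nbhs (0:R)) _) => i j.
  have [+ _] := dc i j.
  by move=> /derivable1_diffP/differentiable_continuous.
by apply; exact: open_nbhs_nbhs.
Qed.

Lemma is_derive_SL (R : realType) (n : nat) (O : set 'M[R]_n) (F : 'M[R]_n -> R)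
    (h : SL R n -> R) (c : R -> SL R n) (V : 'M[R]_n) (g : SL R n) :
  c 0 = g -> open O -> O g -> smooth_on O F -> (forall g : SL R n, O g -> F g = h g) ->
  (forall i j, is_derive (0 : R) (1 : R) (fun t => c t i j) (V i j)) ->
  is_derive (0 : R) (1 : R) (h \o c) (mx_diff F g V).
Proof.
move=> <- oO Oc sF Fh dc.
apply: (@near_eq_is_derive _ _ _ (F \o (fun t => c t : 'M[R]_n))).
  by near=> t; apply: Fh; near: t; exact: near_SL dc.
exact: (is_derive_curve (c := fun t => c t : 'M[R]_n) oO).
Unshelve. all: by end_near.
Qed.

(** [lie_derive] for one of the two real components of a function. *)
Definition real_lie_derive (R : realType) (n : nat) (Y : 'M[R]_n)
    (h : X R n -> R) (x : X R n) : R :=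
  derive1 (fun t : R => h (actX x (expSL (t *: Y)))) 0.

Lemma expSLE (R : realType) (n : nat) (Y : 'M[R]_n) : \tr Y = 0 ->
  (expSL Y : 'M[R]_n) = expmx Y.
Proof.
move=> trY; rewrite /expSL /mx_of_SL insubdK//.
by apply: mem_set; exact: det_expmx.
Qed.

(** The curve [g * exp (t Y)] has velocity [g Y] at [t = 0].  Since the right
    hand side is linear in [Y], so are the Lie derivatives. *)
Lemma real_lie_deriveE (R : realType) (n : nat) (Y : 'M[R]_n) (h : X R n -> R)
    (O : set 'M[R]_n) (F : 'M[R]_n -> R) (g : SL R n) :
  \tr Y = 0 -> open O -> O g -> smooth_on O F ->
  (forall g : SL R n, O g -> F g = h (piX g)) ->
  real_lie_derive Y h (piX g) = mx_diff F g (g *m Y).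
Proof.
move=> trY oO Og sF Fh.
have trZ t : \tr (t *: Y) = 0 by rewrite linearZ/= trY mulr0.
have c0 : SLM g (expSL (0 *: Y)) = g.
  by apply: SL_inj; rewrite SLME expSLE// expmx_scale0 mulmx1.
rewrite /real_lie_derive derive1E.
rewrite (_ : (fun t => _) = (h \o @piX R n) \o (fun t => SLM g (expSL (t *: Y)))); last first.
  by apply/funext => t /=; rewrite actX_pi.
have H := @is_derive_SL R n O F (h \o @piX R n) (fun t => SLM g (expSL (t *: Y))) (g *m Y) g c0 oO.
suff D i j : is_derive (0 : R) (1 : R) (fun t => SLM g (expSL (t *: Y)) i j) ((g *m Y) i j).
  by have [_] := H Og sF Fh D.
rewrite (_ : (fun t => _) = \sum_(k < n) (fun t => g i k * expmx (t *: Y) k j)); last first.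
  apply/funext => t; rewrite SLME mxE fct_sumE; apply: eq_bigr => k _.
  by rewrite expSLE.
rewrite mxE; apply: is_derive_sum => k.
exact: (is_deriveZ (g i k) (is_derive_expmx Y k j)).
Qed.

Lemma real_lie_derive_continuous (R : realType) (n : nat) (Y : 'M[R]_n) (h : X R n -> R) :
  \tr Y = 0 -> smooth_SL (h \o @piX R n) -> continuous (real_lie_derive Y h).
Proof.
move=> trY sh; apply: continuous_X => g.
have [U [F [oU Ug sF Fh]]] := sh g.
have nO : \forall g' \near g, U (mx_of_SL g').
  by apply: (@mx_of_SL_continuous R n g); exact: open_nbhs_nbhs.
have E : \forall g' \near g, mx_diff F (mx_of_SL g') (mx_of_SL g' *m Y) =
    (real_lie_derive Y h \o @piX R n) g'.
  near=> g' => /=; rewrite (real_lie_deriveE trY oU _ sF Fh)//.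
  by near: g'.
apply: cvg_trans; first exact: near_eq_cvg E.
rewrite /= (real_lie_deriveE trY oU Ug sF Fh).
have cv : mx_of_SL g' @[g' --> g] --> mx_of_SL g.
  exact: mx_of_SL_continuous.
apply: cvg_sumr => ij; apply: cvgM.
  rewrite mxE; under eq_fun do rewrite mxE.
  apply: cvg_sumr => k; apply: cvgM; last exact: cvg_cst.
  exact: cvg_mxP cv.
have [cD _] := smooth_on_C1 sF (delta_mx ij.1 ij.2) Ug.
exact: (@continuous_cvg _ _ _ (nbhs g) _ (@mx_of_SL R n) ('D_(delta_mx ij.1 ij.2) F)).
Unshelve. all: by end_near.
Qed.

Lemma smooth_SL_continuous (R : realType) (n : nat) (h : X R n -> R) :
  smooth_SL (h \o @piX R n) -> continuous h.
Proof.
move=> sh; apply: continuous_X => g.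
have [U [F [oU Ug sF Fh]]] := sh g.
have nO : \forall g' \near g, U (mx_of_SL g').
  by apply: (@mx_of_SL_continuous R n g); exact: open_nbhs_nbhs.
have E : \forall g' \near g, F (mx_of_SL g') = (h \o @piX R n) g'.
  by near=> g'; apply: Fh; near: g'.
apply: cvg_trans; first exact: near_eq_cvg E.
rewrite -(Fh _ Ug).
have [cF _] := sF [::] _ Ug.
exact: (@continuous_cvg _ _ _ (nbhs g) _ (@mx_of_SL R n) F _ cF (@mx_of_SL_continuous R n g)).
Unshelve. all: by end_near.
Qed.

(** Products of two elementary matrices of the upper-right block vanish, so
    the image under [horo_mx] of a segment of direction [v] has velocity
    [horo_mx * Yv] at all its points, with the same [Yv]. *)
Lemma mul_block_delta (R : realType) (n m d : nat) (e : block_coord n m d)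
    (t : 'I_d -> R) k :
  horo_mx e t *m delta_mx (e k).1 (e k).2 = delta_mx (e k).1 (e k).2 :> 'M[R]_n.
Proof.
rewrite /horo_mx mulmxDl mul1mx mulmx_suml big1 ?addr0// => l _.
rewrite -scalemxAl mul_delta_mx_cond.
have /andP[_ ml] : ((e l).1 < m <= (e l).2)%N by apply/coordP; exists l.
have /andP[mk _] : ((e k).1 < m <= (e k).2)%N by apply/coordP; exists k.
by case: eqP => [E|_]; [move: ml; rewrite E leqNgt mk | rewrite mulr0n scaler0].
Qed.

Lemma tr_block_delta (R : realType) (n m d : nat) (e : block_coord n m d) k :
  \tr (delta_mx (e k).1 (e k).2 : 'M[R]_n) = 0.
Proof.
have /andP[lm ml] : ((e k).1 < m <= (e k).2)%N by apply/coordP; exists k.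
rewrite /mxtrace big1// => i _; rewrite mxE.
case: eqP => // i1; case: eqP => // i2; move: lm ml; rewrite -i1 -i2 => lm.
by rewrite leqNgt lm.
Qed.

(** Bounds all coordinates on [B] of an elementary matrix. *)
Definition basis_const (R : realType) (n N : nat) (B : N.-tuple 'M[R]_n) : R :=
  \sum_(ij : 'I_n * 'I_n) \sum_(k < N) `|coord B k (delta_mx ij.1 ij.2)|.

Lemma mem_slie (R : realType) (n : nat) (Y : 'M[R]_n) : (Y \in slie) = (\tr Y == 0).
Proof. by rewrite memv_ker lfunE. Qed.

(** Along the segment from [t'] to [t] the orbit has velocity [gam x *m Yv]
    with a fixed [Yv] of the Lie algebra; expanding [Yv] on the basis [B] bounds
    the derivative of [h] along the segment, and the mean value theorem
    concludes. *)
Lemma orbit_lipschitz (R : realType) (n m d : nat) (e : block_coord n m d)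
    (B : (\dim (@slie R n)).-tuple 'M[R]_n) (hB : basis_of (@slie R n) B)
    (h : X R n -> R) (s : R) (g0 : SL R n) :
  0 <= s ->
  smooth_SL (h \o @piX R n) ->
  (forall k x, `|real_lie_derive (tnth B k) h x| <= s) ->
  forall t t' : 'I_d -> R,
  `|h (actX (piX g0) (horo e t)) - h (actX (piX g0) (horo e t'))|
    <= basis_const B * s * \sum_(i < d) `|t i - t' i|.
Proof.
move=> s0 sh hs t t'.
pose v i := t i - t' i.
pose Yv : 'M[R]_n := \sum_(k < d) v k *: delta_mx (e k).1 (e k).2.
pose gam (x : R) := SLM g0 (horo e (fun i => t' i + x * v i)).
pose phi := h \o @piX R n \o gam.
have trB k : \tr (tnth B k) = 0.
  by apply/eqP; rewrite -mem_slie; apply: (basis_mem hB); exact: mem_tnth.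
have YvE : Yv = \sum_k coord B k Yv *: tnth B k.
  rewrite {1}(@coord_basis _ _ _ _ _ Yv hB); first by apply: eq_bigr => k _; rewrite (tnth_nth 0).
  rewrite mem_slie /Yv raddf_sum big1// => k _.
  by rewrite /= mxtraceZ tr_block_delta mulr0.
have horoD x y : horo_mx e (fun i => t' i + (x + y) * v i) =
   horo_mx e (fun i => t' i + x * v i) + y *: (horo_mx e (fun i => t' i + x * v i) *m Yv).
  rewrite {1 2}/horo_mx -addrA; congr (_ + _).
  rewrite /Yv mulmx_sumr scaler_sumr -big_split/=; apply: eq_bigr => k _.
  by rewrite -scalemxAr mul_block_delta scalerA -scalerDl mulrDl addrA.
have der (x : R) : exists2 dd : R, is_derive x 1 phi dd &
    `|dd| <= basis_const B * s * \sum_(i < d) `|v i|.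
  have [U [F [oU Ug sF Fh]]] := sh (gam x).
  exists (mx_diff F (gam x) (gam x *m Yv)).
    apply: is_derive_cvg.
    have gE y : gam (x + y) = mx_of_SL (gam x) + y *: (mx_of_SL (gam x) *m Yv) :> 'M[R]_n.
      have hE t0 : mx_of_SL (horo e t0) = horo_mx e t0 by [].
      by rewrite /gam !SLME !hE horoD mulmxDr -scalemxAr mulmxA.
    have dg i j : is_derive (0 : R) (1 : R) (fun y => gam (x + y) i j) ((gam x *m Yv) i j).
      rewrite (_ : (fun y => _) = cst (gam x i j) + (gam x *m Yv) i j *: (id : R -> R)); last first.
        by apply/funext => y; rewrite gE !mxE mulrC.
      have := is_deriveD (is_derive_cst (gam x i j) (0 : R) (1 : R))
        (is_deriveZ ((gam x *m Yv) i j) (is_derive_id (0 : R) (1 : R))).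
      by rewrite add0r -[X in is_derive _ _ _ X]/(_ * 1) mulr1.
    have gx0 : gam (x + 0) = gam x by rewrite addr0.
    have /is_derive_cvgP := @is_derive_SL R n U F (h \o @piX R n)
      (fun y => gam (x + y)) (gam x *m Yv) (gam x) gx0 oU Ug sF Fh dg.
    rewrite /= gx0.
    by under eq_fun do rewrite add0r.
  rewrite YvE mulmx_sumr.
  under eq_bigr do rewrite -scalemxAr.
  rewrite mx_diff_sum (le_trans (ler_norm_sum _ _ _))//.
  apply: (@le_trans _ _
    (\sum_k (\sum_(l < d) `|v l| * `|coord B k (delta_mx (e l).1 (e l).2)|) * s)).
    apply: ler_sum => k _; rewrite normrM ler_pM//.
      rewrite /Yv linear_sum/= (le_trans (ler_norm_sum _ _ _))//.
      by apply: ler_sum => l _; rewrite linearZ/= normrM.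
    by rewrite -(real_lie_deriveE (trB k) oU Ug sF Fh).
  rewrite -mulr_suml mulrAC ler_wpM2r// exchange_big/= mulr_sumr; apply: ler_sum => l _.
  rewrite -mulr_sumr mulrC ler_wpM2r// /basis_const (bigD1 (e l))//= lerDl.
  by apply: sumr_ge0 => ij _; apply: sumr_ge0.
have [||c _] := @MVT R phi (fun x => projT1 (cid2 (der x))) 0 1 ltr01.
- by move=> x _; case: cid2.
- apply: derivable_within_continuous => x _.
  by have [dd [+ _] _] := der x.
rewrite subr0 mulr1.
have -> : phi 1 = h (actX (piX g0) (horo e t)).
  rewrite /phi /gam /= actX_pi; congr (h (piX (SLM _ (horo e _)))).
  by apply/funext => i; rewrite /v mul1r addrC subrK.
have -> : phi 0 = h (actX (piX g0) (horo e t')).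
  rewrite /phi /gam /= actX_pi; congr (h (piX (SLM _ (horo e _)))).
  by apply/funext => i; rewrite mul0r addr0.
by move=> ->; case: cid2.
Qed.

(** * Real and imaginary parts *)

Section ComplexParts.
Context {R : realType}.

Lemma normc_Re (z : R[i]) : `|complex.Re z| <= Normc.normc z.
Proof.
case: z => a b /=; rewrite -[leLHS]sqrtr_sqr.
by rewrite ler_wsqrtr // lerDl sqr_ge0.
Qed.

Lemma normc_Im (z : R[i]) : `|complex.Im z| <= Normc.normc z.
Proof.
case: z => a b /=; rewrite -[leLHS]sqrtr_sqr.
by rewrite ler_wsqrtr // lerDr sqr_ge0.
Qed.

Lemma normc_le_ReIm (z : R[i]) :
  Normc.normc z <= `|complex.Re z| + `|complex.Im z|.
Proof.
case: z => a b /=; rewrite -[leRHS]ger0_norm ?addr_ge0// -sqrtr_sqr ler_wsqrtr//.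
rewrite sqrrD !real_normK ?num_real// lerD2r lerDl.
by rewrite mulrn_wge0// mulr_ge0.
Qed.

Lemma Re_sub (z w : R[i]) :
  complex.Re (z - w) = complex.Re z - complex.Re w.
Proof. by case: z => a a'; case: w. Qed.

Lemma Im_sub (z w : R[i]) :
  complex.Im (z - w) = complex.Im z - complex.Im w.
Proof. by case: z => a a'; case: w. Qed.

Lemma Re_sum (I : Type) (r : seq I) (F : I -> R[i]) :
  complex.Re (\sum_(i <- r) F i) = \sum_(i <- r) complex.Re (F i).
Proof.
elim: r => [|i r IH]; rewrite ?big_nil// !big_cons -IH.
by case: (F i) => a b; case: (\sum_(_ <- _) _).
Qed.

Lemma Im_sum (I : Type) (r : seq I) (F : I -> R[i]) :
  complex.Im (\sum_(i <- r) F i) = \sum_(i <- r) complex.Im (F i).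
Proof.
elim: r => [|i r IH]; rewrite ?big_nil// !big_cons -IH.
by case: (F i) => a b; case: (\sum_(_ <- _) _).
Qed.

Lemma Re_scale (k : R) (z : R[i]) : complex.Re ((k%:C)%C * z) = k * complex.Re z.
Proof. by case: z => x y /=; rewrite mul0r subr0. Qed.

Lemma Im_scale (k : R) (z : R[i]) : complex.Im ((k%:C)%C * z) = k * complex.Im z.
Proof. by case: z => x y /=; rewrite mul0r addr0. Qed.

End ComplexParts.

(** * Sobolev norms control suprema *)

Section SobolevBounds.
Context {R : realType} {n : nat} (mX : probability (borelX R n) R).

Lemma borelX_measurable (h : X R n -> R) : continuous h ->
  measurable_fun setT (h : borelX R n -> R).
Proof.
move=> /continuousP ch.
apply: (measurability _ (RGenOpens.measurableE R)).
move=> _ [_ [a [b ->] <-]]; rewrite setTI.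
by apply: open_measurable_X; apply: ch; exact: interval_open.
Qed.

Lemma mean_le (h : X R n -> R) (s : R) : continuous h -> (forall x, `|h x| <= s) ->
  `|\int[mX]_(x in setT) h x| <= s.
Proof.
move=> ch hs.
have mh := borelX_measurable ch.
have ih : mX.-integrable setT (EFin \o (h : borelX R n -> R)).
  apply: measurable_bounded_integrable => //.
    by rewrite [X in (X < _)%E]probability_setT ltry.
  exists s; split; first exact: num_real.
  by move=> y sy x _; rewrite /= (le_trans (hs x))// ltW.
apply: (le_trans (le_normr_Rintegral _ ih)) => //.
apply: (@le_trans _ _ (\int[mX]_(x in setT) s)).
  apply: le_Rintegral => //.
  - exact: integrable_norm.
  - by apply: finite_measure_integrable_cst.
by rewrite Rintegral_cst// [X in fine X]probability_setT mulr1.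
Qed.

Lemma Lnormy_ae (g : X R n -> R) (s : R) :
  (Lnorm mX +oo (fun x => (g x)%:E) <= s%:E)%E -> \forall x \ae mX, `|g x| <= s.
Proof.
rewrite unlock [X in (0 < X)%E]probability_setT lte01 => /ess_supP.
by apply: filterS => x /=; rewrite lee_fin.
Qed.

Lemma sobolev_term {N : nat} (B : N.-tuple 'M[R]_n) (l : nat) (f : X R n -> R[i])
    (k : 'I_l.+1) (t : k.-tuple 'I_N) :
  (Lnorm mX +oo (fun x => (Normc.normc (lie_monomial (map (tnth B) t) f x))%:E)
   <= sobolev mX B l f)%E.
Proof.
rewrite /sobolev (bigD1 k)//= (bigD1 t)//= -addeA leeDl//.
apply: adde_ge0; last first.
  by apply: sume_ge0 => k' _; apply: sume_ge0 => t' _; exact: Lnorm_ge0.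
by apply: sume_ge0 => t' _; exact: Lnorm_ge0.
Qed.

Hypothesis inv : right_invariant mX.
Variables (B : (\dim (@slie R n)).-tuple 'M[R]_n) (hB : basis_of (@slie R n) B).
Variables (l : nat) (l1 : (1 <= l)%N) (f : X R n -> R[i]) (s : R).
Hypothesis fs : sobolev mX B l f = s%:E.

Let tuple1 (k : 'I_(\dim (@slie R n))) : 1.-tuple 'I_(\dim (@slie R n)) := [tuple k].

(** The monomial of degree 0 bounds [p \o f] almost everywhere, and a continuous
    function is bounded everywhere by an almost sure bound.  Here and below [p]
    stands for the real or the imaginary part. *)
Lemma sobolev_sup (p : R[i] -> R) : (forall z, `|p z| <= Normc.normc z) ->
  continuous (p \o f) -> forall x, `|p (f x)| <= s.
Proof.
move=> hp cp; apply: (@ae_le_everywhere _ _ mX inv (p \o f) s cp).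
have := @sobolev_term _ B l f ord0 [tuple]; rewrite fs => /Lnormy_ae.
apply: negligibleS => x /=; apply: contra_not; apply: le_trans.
by rewrite (le_trans (hp _))// ler_norm.
Qed.

Lemma sobolev_lie_sup (p : R[i] -> R) : (forall z, `|p z| <= Normc.normc z) ->
  (forall Y x, p (lie_derive Y f x) = real_lie_derive Y (p \o f) x) ->
  smooth_SL (p \o f \o @piX R n) ->
  forall k x, `|real_lie_derive (tnth B k) (p \o f) x| <= s.
Proof.
move=> hp pE sp k; apply: (@ae_le_everywhere _ _ mX inv _ s).
  apply: real_lie_derive_continuous => //.
  by apply/eqP; rewrite -mem_slie; apply: (basis_mem hB); exact: mem_tnth.
have := @sobolev_term _ B l f (inord 1) (tcast (esym (inordK (l1 : (1 < l.+1)%N))) (tuple1 k)).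
rewrite fs => /Lnormy_ae.
apply: negligibleS => x /=; apply: contra_not; apply: le_trans.
by rewrite val_tcast /= -pE (le_trans (hp _))// ler_norm.
Qed.

Lemma sobolev_fin_ge0 : 0 <= s.
Proof.
rewrite -lee_fin -fs; apply: sume_ge0 => k' _; apply: sume_ge0 => t' _; exact: Lnorm_ge0.
Qed.

End SobolevBounds.

(** * Fubini on the box *)

Section TupleLebesgue.
Context {R : realType}.
Local Notation RM := (measurableTypeR R).

Definition tbox d (T : R) : set (d.-tuple RM) := [set t | box T (tnth t)].
Arguments tbox : clear implicits.

Lemma measurable_tbox d T : measurable (tbox d T).
Proof.
rewrite (_ : tbox d T =
    \bigcap_(i in [set: 'I_d]) ((fun t : d.-tuple RM => tnth t i) @^-1` `[0, T])).
  apply: fin_bigcap_measurable => // i _; rewrite -[X in measurable X]setTI.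
  by apply: measurable_tnth => //; exact: measurable_itv.
apply/seteqP; split => t /=.
  by move=> H i _ /=; rewrite in_itv/=; exact: H.
by move=> H i; have := H i I; rewrite /= in_itv.
Qed.

(** [F < a] is the union over the rational points [q] of the conditions
    [F q + L * dist t q < a]: each of them implies [F t < a] because [F] is
    Lipschitz, and for [F t < a] a rational point close to [t] witnesses it. *)
Lemma lipschitz_measurable d (F : d.-tuple R -> R) (L : R) : 0 <= L ->
  (forall s t, `|F s - F t| <= L * \sum_(i < d) `|tnth s i - tnth t i|) ->
  measurable_fun setT (F : d.-tuple RM -> RM).
Proof.
move=> L0 FL.
pose dist (t : d.-tuple RM) (q : d.-tuple rat) : RM := \sum_(i < d) `|tnth t i - ratr (tnth q i)|.
pose emb (q : d.-tuple rat) : d.-tuple R := [tuple ratr (tnth q i) | i < d].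
have mdist q : measurable_fun setT (dist^~ q).
  apply: measurable_sum => i.
  apply: measurableT_comp => //; apply: measurable_funB => //.
  exact: measurable_tnth.
apply: (measurability _ (RGenInftyO.measurableE R)).
move=> _ [_ [a ->] <-]; rewrite setTI.
pose A k : set (d.-tuple RM) :=
  if unpickle k is Some q then [set t | F (emb q) + L * dist t q < a] else set0.
rewrite (_ : _ @^-1` _ = \bigcup_k A k).
  apply: bigcup_measurable => k _; rewrite /A; case: unpickle => // q.
  rewrite -[X in measurable X]setTI.
  have mf : measurable_fun setT (fun t => F (emb q) + L * dist t q).
    apply: measurable_funD; first exact: measurable_cst.
    by apply: measurable_funM; [exact: measurable_cst|exact: mdist].
  have := mf measurableT `]-oo, a[%classic (measurable_itv _).
  by congr (measurable (_ `&` _)); apply/seteqP; split => t /=; rewrite in_itv.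
have dE t q : L * dist t q = L * \sum_(i < d) `|tnth t i - tnth (emb q) i|.
  by congr (_ * _); apply: eq_bigr => i _; rewrite tnth_mktuple.
apply/seteqP; split => t /=; rewrite in_itv/=; last first.
  move=> [k _]; rewrite /A; case: unpickle => // q /=; rewrite dE; apply: le_lt_trans.
  by rewrite -lerBlDl (le_trans (ler_norm _))// FL.
move=> Fta.
(* Replacing t by a point at distance e in every coordinate loses at most
   2 * L * d * e, which has to be less than a - F t. *)
pose e := (a - F t) / (2 * L * d%:R + 1).
have e0 : 0 < e by rewrite divr_gt0 ?subr_gt0// ltr_wpDl// !mulr_ge0.
have /(_ _)/cid hq i : exists q : rat, `|tnth t i - ratr q| < e.
  have [|q] := @rat_in_itvoo R (tnth t i - e) (tnth t i + e).
    by rewrite ltrBlDr -addrA ltrDl addr_gt0.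
  by rewrite in_itv/= => tq; exists q; rewrite ltr_distlC.
pose q := [tuple projT1 (hq i) | i < d].
exists (pickle q) => //; rewrite /A pickleK/=.
have D : L * dist t q <= L * d%:R * e.
  rewrite -mulrA ler_wpM2l// /dist mulr_natl -[X in _ *+ X]card_ord -sumr_const.
  by apply: ler_sum => i _; rewrite tnth_mktuple ltW//; exact: (projT2 (hq i)).
have := FL (emb q) t; rewrite (eq_bigr (fun i => `|tnth t i - tnth (emb q) i|)); last first.
  by move=> i _; rewrite distrC.
rewrite -dE => Fq.
have Fq' : F (emb q) <= F t + L * dist t q by rewrite -lerBlDl (le_trans (ler_norm _)).
have E : 2 * (L * d%:R * e) < a - F t.
  have -> : a - F t = 2 * (L * d%:R * e) + e.
    by rewrite /e; field; rewrite gt_eqF// ltr_wpDl// !mulr_ge0.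
  by rewrite ltrDl.
lra.
Qed.

Lemma preimage_tbox d (T : R) : @tuple_consp R d @^-1` tbox d.+1 T = `[0, T] `*` tbox d T.
Proof.
apply/seteqP; split => -[x t] /=.
  move=> H; split => [|i]; first by have := H ord0; rewrite in_itv /= (tnth_nth 0).
  by have := H (lift ord0 i); rewrite !(tnth_nth 0).
move=> [+ H] i; rewrite in_itv/= => x0.
by case: (unliftP ord0 i) => [j ->|->]; [have := H j|move: x0]; rewrite !(tnth_nth 0).
Qed.

Lemma tbox_fin d (T : R) : (lebesgue_tuple d (tbox d T) < +oo)%E.
Proof.
elim: d => [|d IH].
  rewrite /= /dirac/= indicE; case: (_ \in _) => //; exact: ltry.
rewrite /= /cons_measure /pushforward.
rewrite preimage_tbox product_measure1E//; last exact: measurable_tbox.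
apply: lte_mul_pinfty; [exact: measure_ge0| |exact: IH].
have itvE : lebesgue_measure `[0, T]%classic = (if (0 < T)%R then (T - 0)%:E else 0)%E.
  by rewrite lebesgue_measure_itv /= lte_fin -EFinB.
by rewrite [X in X \is a _]itvE; case: ifP.
Qed.

Lemma tbox_integrable d (T M : R) (h : d.-tuple RM -> R) :
  measurable_fun setT h -> (forall t, tbox d T t -> `|h t| <= M) ->
  (lebesgue_tuple d).-integrable (tbox d T) (EFin \o h).
Proof.
move=> mh hM; apply: measurable_bounded_integrable.
- exact: measurable_tbox.
- exact: tbox_fin.
- exact: measurable_funTS.
- exists M; split; first exact: num_real.
  by move=> y My t tT; rewrite /= (le_trans (hM _ tT))// ltW.
Qed.

(** Fubini for the first coordinate; the inner integral is only known to be
    integrable, which is why this is part of the conclusion. *)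
Lemma integral_tbox_recl d (T M : R) (h : d.+1.-tuple RM -> R) :
  measurable_fun setT h -> (forall t, `|h t| <= M) ->
  (@lebesgue_measure R).-integrable `[0, T]
     (EFin \o (fun x => \int[lebesgue_tuple d]_(t in tbox d T) h (tuple_consp (x, t)))) /\
  \int[lebesgue_tuple d.+1]_(t in tbox d.+1 T) h t =
  \int[lebesgue_measure]_(x in `[0, T])
    \int[lebesgue_tuple d]_(t in tbox d T) h (tuple_consp (x, t)).
Proof.
move=> mh hM.
pose m1 := (@lebesgue_measure R) : {sigma_finite_measure set RM -> \bar R}.
pose m2 := @lebesgue_tuple R d.
pose D : set (RM * d.-tuple RM) := `[0, T]%classic `*` tbox d T.
have mI : measurable (`[0, T]%classic : set RM) by exact: measurable_itv.
have mD : measurable D by apply: measurableX => //; exact: measurable_tbox.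
have mc := @measurable_tuple_consp R d.
have mhc : measurable_fun setT (h \o @tuple_consp R d) by exact: measurableT_comp.
have Dfin : ((m1 \x m2)%E D < +oo)%E.
  have := @tbox_fin d.+1 T.
  by rewrite /= /cons_measure /pushforward preimage_tbox.
have iD : (m1 \x m2)%E.-integrable D (EFin \o (h \o @tuple_consp R d)).
  apply: measurable_bounded_integrable => //; first exact: measurable_funTS.
  exists M; split; first exact: num_real.
  by move=> y My z _; rewrite /= (le_trans (hM _))// ltW.
pose f := (EFin \o (h \o @tuple_consp R d)) \_ D.
have if_ : (m1 \x m2)%E.-integrable setT f by apply/(integrable_mkcond _ mD).
have mhx x : measurable_fun setT (fun t => h (tuple_consp (x, t))).
  by apply: (measurableT_comp (f := h \o @tuple_consp R d) (g := pair x)) => //.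
have ihx x : m2.-integrable (tbox d T) (EFin \o (fun t => h (tuple_consp (x, t)))).
  by apply: tbox_integrable => //.
have FE x : (\int[m2]_y f (x, y))%E =
   ((EFin \o (fun x => \int[m2]_(t in tbox d T) h (tuple_consp (x, t)))) \_ `[0, T]%classic) x.
  rewrite /f /patch /=.
  case: ifPn => [|] x0.
    have ifin := integrable_fin_num (@measurable_tbox d T) (ihx x).
    rewrite /Rintegral (fineK ifin).
    rewrite [RHS]integral_mkcond; apply: eq_integral => y _; rewrite /patch /=.
    congr (if _ then _ else _).
    by rewrite /D in_setX/= x0.
  rewrite integral0_eq// => y _.
  by rewrite /D in_setX/= (negbTE x0).
have iF := @integrable_fubini_F _ _ _ _ _ m1 m2 f if_.
have FE' : fubini_F m2 f =
  ((EFin \o (fun x => \int[m2]_(t in tbox d T) h (tuple_consp (x, t)))) \_ `[0, T]%classic).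
  by apply/funext => x; rewrite -FE.
split; first by apply/(integrable_mkcond _ mI); rewrite -FE'.
rewrite /Rintegral; congr fine.
transitivity (\int[pushforward (m1 \x m2) (@tuple_consp R d)]_(t in tbox d.+1 T) (h t)%:E)%E.
  exact: eq_measure_integral.
rewrite integral_pushforward//.
- rewrite preimage_tbox integral_mkcond -/f -(integral12_prod_meas1 if_).
  rewrite -/(fubini_F m2 f) FE' [RHS]integral_mkcond.
  by apply: eq_integral.
- exact/measurable_EFinP.
- by rewrite preimage_tbox.
- exact: measurable_tbox.
Qed.

End TupleLebesgue.
Arguments tbox {R} d T.

(** * Integrals over intervals and trigonometric bounds *)

Section IntervalIntegral.
Context {R : realType}.
Implicit Types (f h : R -> R) (a b c : R).

Definition itvI a b f : R := \int[lebesgue_measure]_(x in `[a, b]) f x.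

Lemma itvI_integrable a b f : continuous f ->
  (@lebesgue_measure R).-integrable `[a, b] (EFin \o f).
Proof.
move=> cf; apply: continuous_compact_integrable; first exact: segment_compact.
exact: continuous_subspaceT.
Qed.

Lemma itvI_FTC (F f : R -> R) a b : continuous f -> (forall x : R, is_derive x 1 F (f x)) ->
  a <= b -> itvI a b f = F b - F a.
Proof.
move=> cf dF; rewrite le_eqVlt => /predU1P[<-|ab].
  by rewrite /itvI set_itv1 Rintegral_set1 subrr.
rewrite /itvI /Rintegral (@continuous_FTC2 _ f F a b ab) ?EFinB//.
- exact: continuous_subspaceT.
- have cF x : {for x, continuous F}.
    have [+ _] := dF x.
    by move=> /derivable1_diffP/differentiable_continuous.
  split.
  + by move=> x _; have [] := dF x.
  + by apply: cvg_at_right_filter; exact: cF.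
  + by apply: cvg_at_left_filter; exact: cF.
- by move=> x _; rewrite derive1E; have [_] := dF x.
Qed.

Lemma itvI_chasles a b c f : continuous f -> a <= b -> b <= c ->
  itvI a c f = itvI a b f + itvI b c f.
Proof.
move=> cf ab bc.
have := @Rintegral_itvB R f (BLeft a) (BRight c) b (itvI_integrable a c cf).
rewrite !bnd_simp => /(_ ab bc) /eqP; rewrite subr_eq addrC => /eqP E.
rewrite /itvI E; congr (_ + _); rewrite Rintegral_itv_obnd_cbnd//.
apply: integrableS (itvI_integrable b c cf) => //.
by apply: subset_itv; rewrite bnd_simp.
Qed.

Lemma itvI_le a b f h : continuous f -> continuous h ->
  (forall x, a <= x <= b -> f x <= h x) -> itvI a b f <= itvI a b h.
Proof.
by move=> cf ch fh; apply: le_Rintegral => //; exact: itvI_integrable.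
Qed.

Lemma itvI_norm a b f : continuous f -> `|itvI a b f| <= itvI a b (fun x => `|f x|).
Proof. by move=> cf; apply: le_normr_Rintegral => //; exact: itvI_integrable. Qed.

Lemma itvID a b f h : continuous f -> continuous h ->
  itvI a b (fun x => f x + h x) = itvI a b f + itvI a b h.
Proof. by move=> cf ch; rewrite /itvI RintegralD//; exact: itvI_integrable. Qed.

Lemma itvIB a b f h : continuous f -> continuous h ->
  itvI a b (fun x => f x - h x) = itvI a b f - itvI a b h.
Proof. by move=> cf ch; rewrite /itvI RintegralB//; exact: itvI_integrable. Qed.

Lemma itvIZ a b f k : continuous f -> itvI a b (fun x => k * f x) = k * itvI a b f.
Proof. by move=> cf; rewrite /itvI RintegralZl//; exact: itvI_integrable. Qed.

Lemma continuous_sumr (I : Type) (r : seq I) (F : I -> R -> R) :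
  (forall i, continuous (F i)) -> continuous (fun x => \sum_(i <- r) F i x).
Proof.
move=> cF x; elim: r => [|i r IH].
  by under eq_fun do rewrite big_nil; exact: cvg_cst.
by under eq_fun do rewrite big_cons; apply: cvgD => //; exact: cF.
Qed.

Lemma itvI_sum (I : Type) (r : seq I) a b (F : I -> R -> R) :
  (forall i, continuous (F i)) ->
  itvI a b (fun x => \sum_(i <- r) F i x) = \sum_(i <- r) itvI a b (F i).
Proof.
move=> cF; elim: r => [|i r IH].
  rewrite big_nil; under eq_fun do rewrite big_nil.
  by rewrite /itvI Rintegral_cst// mul0r.
rewrite big_cons -IH -itvID//; last exact: continuous_sumr.
by under eq_fun do rewrite big_cons.
Qed.

Lemma itvI_cst a b k : a <= b -> itvI a b (fun=> k) = k * (b - a).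
Proof.
move=> ab; rewrite /itvI Rintegral_cst//.
have itvE : lebesgue_measure `[a, b]%classic = (if (a < b)%R then (b - a)%:E else 0)%E.
  by rewrite lebesgue_measure_itv /= lte_fin -EFinB.
rewrite [X in _ * fine X]itvE.
by case: ltgtP ab => //= -> _; rewrite subrr.
Qed.

End IntervalIntegral.

Section Trig.
Context {R : realType}.
Implicit Types (x y w : R).

Lemma continuous_cosM w : continuous (fun x => cos (w * x)).
Proof.
move=> x; apply: continuous_comp; last exact: continuous_cos.
by apply: cvgM; [exact: cvg_cst|exact: cvg_id].
Qed.

Lemma sin_periodz x (z : int) : sin (x + z%:~R * (pi *+ 2)) = sin x.
Proof.
case: z => n; first by rewrite -[_%:~R]/(n%:R) mulr_natl (periodicn (@sinD2pi R)).
rewrite NegzE mulrNz mulNr -[_%:~R]/(n.+1%:R) mulr_natl.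
by rewrite -[LHS](periodicn (@sinD2pi R) n.+1) subrK.
Qed.

Lemma itvI_cos (a K : R) (z : int) : 0 < K ->
  itvI a (a + K) (fun x => cos (z%:~R * (2 * pi / K) * x)) = if z == 0 then K else 0.
Proof.
move=> K0; have aK : a <= a + K by rewrite lerDl ltW.
have [->|z0] := eqVneq z 0.
  under eq_fun do rewrite !mul0r cos0.
  by rewrite itvI_cst// mul1r addrC addKr.
set w := _ * _; have w0 : w != 0.
  by rewrite /w !mulf_neq0 ?intr_eq0// ?invr_eq0 gt_eqF// pi_gt0.
have dF (x : R) : is_derive x 1 (fun x => w^-1 * sin (w * x)) (cos (w * x)).
  have d1 : is_derive x 1 ( *%R w) w.
    have := is_deriveZ w (is_derive_id x (1 : R)).
    by rewrite -[X in is_derive _ _ _ X]/(_ * 1) mulr1.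
  have := is_deriveZ w^-1 (is_derive1_comp (is_derive_sin (w * x)) d1).
  by rewrite -[X in is_derive _ _ _ X]/(_ * (_ * _)) mulrCA mulVf// mulr1.
rewrite (itvI_FTC (@continuous_cosM w) dF aK).
have -> : w * (a + K) = w * a + z%:~R * (pi *+ 2).
  by rewrite mulrDr; congr (_ + _); rewrite /w -mulr_natl; field; rewrite gt_eqF.
by rewrite sin_periodz subrr.
Qed.

Lemma cos2_ge_half x : 0 <= x <= pi / 4 -> 1 / 2 <= cos x ^+ 2.
Proof.
move=> /andP[x0 xp].
have : 0 <= cos (x + x).
  apply: cos_ge0_pihalf; have := @pi_gt0 R => p0.
  by apply/andP; split; lra.
by rewrite cosD -!expr2 sin2cos2; lra.
Qed.

(** [1 - cos x = 8 sin^2 v cos^2 v] for [v = x / 4]; as [v <= pi / 4], both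
    [cos^2 v] and the square of the slope of [sin] on [0, v] are at least 1/2. *)
Lemma one_sub_cos_ge x : `|x| <= pi -> x ^+ 2 / 8 <= 1 - cos x.
Proof.
wlog x0 : x / 0 <= x.
  move=> H; have [/H//|/ltW x0] := leP 0 x.
  by have := H (- x); rewrite oppr_ge0 normrN cosN sqrrN; apply.
rewrite ger0_norm// => xpi.
pose v := x / 4.
have v4 : 0 <= v <= pi / 4 by rewrite /v; lra.
have xE : x = (v + v) + (v + v) by rewrite /v; field.
have sv : v ^+ 2 / 2 <= sin v ^+ 2.
  have [||c + E] := @MVT_segment R sin cos 0 v _.
  - by case/andP: v4.
  - by apply: continuous_subspaceT; exact: continuous_sin.
  rewrite in_itv/= => cv; move: E; rewrite sin0 !subr0 => ->.
  have c4 : 0 <= c <= pi / 4 by lra.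
  by have := cos2_ge_half c4; rewrite exprMn; nra.
have cv := cos2_ge_half v4.
have -> : 1 - cos x = 8 * sin v ^+ 2 * cos v ^+ 2.
  have := cos2Dsin2 v; rewrite xE !(cosD, sinD).
  set s := sin v; set c := cos v => cs.
  rewrite -[X in X - _](expr1n _ 2) -{1}cs; ring.
have -> : x ^+ 2 / 8 = 8 * (v ^+ 2 / 2) * (1 / 2) by rewrite /v; field.
have v2 : 0 <= v ^+ 2 by exact: sqr_ge0.
nra.
Qed.
End Trig.

(** * The Jackson kernel *)

Section Jackson.
Context {R : realType}.
Implicit Types (x y w : R).

Definition cis x : R[i] := (cos x +i* sin x)%C.

Lemma cisD x y : cis (x + y) = cis x * cis y.
Proof. by rewrite /cis cosD sinD; simpc; congr (_ +i* _)%C; ring. Qed.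

Lemma cis0 : cis 0 = 1.
Proof. by rewrite /cis cos0 sin0. Qed.

Lemma cisMn k y : cis (k%:R * y) = cis y ^+ k.
Proof.
elim: k => [|k IH]; first by rewrite mul0r cis0.
by rewrite -natr1 mulrDl mul1r cisD IH exprSr.
Qed.

Lemma normc_sq (z : R[i]) : ((Normc.normc z ^+ 2)%:C)%C = z * (z^*)%C.
Proof.
case: z => a b /=; rewrite sqr_sqrtr ?addr_ge0 ?sqr_ge0//.
by simpc; congr (_ +i* _)%C; ring.
Qed.

Lemma normsq_sum_cis (J : finType) (m : J -> nat) y :
  ((Normc.normc (\sum_j cis ((m j)%:R * y)) ^+ 2)%:C)%C =
  \sum_(p : J * J) cis (((m p.1)%:Z - (m p.2)%:Z)%:~R * y).
Proof.
rewrite normc_sq rmorph_sum/= big_distrlr/= pair_big/=; apply: eq_bigr => -[i j] _ /=.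
rewrite intrB mulrBl cisD; congr (_ * _).
by rewrite /cis cosN sinN.
Qed.

Lemma normsq_sum_cis_re (J : finType) (m : J -> nat) y :
  Normc.normc (\sum_j cis ((m j)%:R * y)) ^+ 2 =
  \sum_(p : J * J) cos (((m p.1)%:Z - (m p.2)%:Z)%:~R * y).
Proof. by have /(congr1 (@complex.Re R)) := normsq_sum_cis m y; rewrite Re_sum. Qed.

Lemma normsq_1Bcis y : Normc.normc (1 - cis y) ^+ 2 = 2 * (1 - cos y).
Proof.
rewrite /cis /= sqr_sqrtr ?addr_ge0 ?sqr_ge0// sub0r.
by have := cos2Dsin2 y; rewrite sqrrN; set c := cos y; set s := sin y; nra.
Qed.

(** The mean over a period of the fourth power of the modulus of the Dirichlet
    kernel with [N] terms. *)
Definition coincidence (N : nat) : R :=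
  \sum_(p : ('I_N * 'I_N) * ('I_N * 'I_N))
    (p.1.1 + p.1.2 == p.2.1 + p.2.2 :> nat)%N%:R.

(** Let [r s] be the number of representations of [s < 2 N] as [a + b].  The sum
    of the [r s] is [N ^+ 2] and that of their squares is the number of
    coincidences; expanding the sum of the squares of [r s - N / 2], which is
    nonnegative, gives the bound. *)
Lemma coincidence_ge N : N%:R ^+ 3 / 2 <= coincidence N.
Proof.
pose r (s : nat) : R := \sum_(p : 'I_N * 'I_N) (p.1 + p.2 == s :> nat)%N%:R.
have ltN (p : 'I_N * 'I_N) : (p.1 + p.2 < N + N)%N.
  by have := ltn_ord p.1; have := ltn_ord p.2; lia.
have delta_sum (a : nat) (G : nat -> R) : (a < N + N)%N ->
    \sum_(s < N + N) (a == s :> nat)%N%:R * G s = G a.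
  move=> aN; rewrite (bigD1 (Ordinal aN))//= eqxx mul1r big1 ?addr0// => s sa.
  suff /negbTE -> : a != s by rewrite mul0r.
  by apply: contra sa => /eqP as_; apply/eqP/val_inj.
have r1 : \sum_(s < N + N) r s = N%:R ^+ 2.
  rewrite exchange_big/= (eq_bigr (fun=> 1)) => [|p _]; last first.
    rewrite -[RHS](delta_sum _ (fun=> 1) (ltN p)).
    by apply: eq_bigr => s _; rewrite mulr1.
  by rewrite sumr_const card_prod card_ord mulnn natrX.
have r2 : \sum_(s < N + N) r s ^+ 2 = coincidence N.
  under eq_bigr do rewrite expr2 big_distrlr/= pair_big/=.
  rewrite exchange_big/=; apply: eq_bigr => p _.
  have := delta_sum _ (fun s => (p.2.1 + p.2.2 == s :> nat)%N%:R) (ltN p.1).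
  by move=> ->; rewrite eq_sym.
have : 0 <= \sum_(s < N + N) (r s - N%:R / 2) ^+ 2 by apply: sumr_ge0 => s _; exact: sqr_ge0.
rewrite (eq_bigr (fun s : 'I_(N + N) => r s ^+ 2 - N%:R * r s + N%:R ^+ 2 / 4)); last first.
  by move=> s _; field.
rewrite big_split/= sumrB r2 -mulr_sumr r1 sumr_const card_ord mulrnDr -[_ / 4 *+ N]mulr_natr.
have -> : N%:R ^+ 2 / 4 * N%:R + N%:R ^+ 2 / 4 * N%:R = N%:R ^+ 3 / 2 :> R by field.
rewrite -exprS => H.
have E : N%:R ^+ 3 = N%:R ^+ 3 / 2 + N%:R ^+ 3 / 2 :> R by field.
lra.
Qed.

Lemma continuous_sum_cos (J : finType) (m : J -> R) :
  continuous (fun x => \sum_j cos (m j * x)).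
Proof. by apply: continuous_sumr => j; exact: continuous_cosM. Qed.

(** A smoothed version, at scale [delta], of the sum of unit point masses at the
    multiples of [K].  The first moment is what an integral against a Lipschitz
    function sees; it is taken around nonnegative multiples of [K] only, as the
    box contains no others. *)
Definition quad_kernel (K delta : R) (g : R -> R) : Prop :=
  [/\ continuous g, forall x, 0 <= g x, forall a, itvI a (a + K) g = 1 &
    forall k : nat, itvI (k%:R * K - K / 2) (k%:R * K + K / 2)
      (fun x => g x * `|x - k%:R * K|) <= delta].

(** [D] is the Dirichlet kernel with [N] terms and [S] its squared modulus, the
    Fejer kernel up to a factor; [g] is [S ^+ 2] divided by its mass. *)
Section JacksonKernel.
Variables (K : R) (N : nat).
Hypotheses (K0 : 0 < K) (N0 : (0 < N)%N).
Let w := 2 * pi / K.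
Let D x := \sum_(a < N) cis (a%:R * (w * x)).
Let S x := Normc.normc (D x) ^+ 2.
Let C := K * coincidence N.
Let g x := C^-1 * S x ^+ 2.

Let SE x : S x = \sum_(p : 'I_N * 'I_N) cos ((p.1%:Z - p.2%:Z)%:~R * w * x).
Proof.
rewrite /S /D (normsq_sum_cis_re (@nat_of_ord N)).
by apply: eq_bigr => p _; rewrite mulrA.
Qed.

Let D2 x : D x ^+ 2 = \sum_(p : 'I_N * 'I_N) cis ((p.1 + p.2)%N%:R * (w * x)).
Proof.
rewrite expr2 /D big_distrlr/= pair_big/=; apply: eq_bigr => -[a b] _ /=.
by rewrite natrD mulrDl cisD.
Qed.

Let S2 x : S x ^+ 2 = Normc.normc (D x ^+ 2) ^+ 2.
Proof. by rewrite /S expr2 Normc.normcM -!expr2. Qed.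

Let S2E x : S x ^+ 2 = \sum_(p : ('I_N * 'I_N) * ('I_N * 'I_N))
   cos (((p.1.1 + p.1.2)%N%:Z - (p.2.1 + p.2.2)%N%:Z)%:~R * w * x).
Proof.
rewrite S2 D2 (normsq_sum_cis_re (fun p : 'I_N * 'I_N => p.1 + p.2)%N).
by apply: eq_bigr => p _; rewrite mulrA.
Qed.

Let S2cE x : ((S x ^+ 2)%:C)%C = \sum_(p : ('I_N * 'I_N) * ('I_N * 'I_N))
   cis (((p.1.1 + p.1.2)%N%:Z - (p.2.1 + p.2.2)%N%:Z)%:~R * w * x).
Proof.
rewrite S2 D2 (normsq_sum_cis (fun p : 'I_N * 'I_N => p.1 + p.2)%N).
by apply: eq_bigr => p _; rewrite mulrA.
Qed.

Let S_ge0 x : 0 <= S x. Proof. exact: sqr_ge0. Qed.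

(** The geometric sum: [|1 - cis (w x)| |D x| = |1 - cis (N w x)| <= 2]. *)
Let S_cos x : S x * (1 - cos (w * x)) <= 2.
Proof.
have geo : (1 - cis (w * x)) * D x = 1 - cis (N%:R * (w * x)).
  rewrite /D (eq_bigr (fun a : 'I_N => cis (w * x) ^+ a)) => [|a _]; last by rewrite cisMn.
  by rewrite cisMn -[RHS]opprB subrX1 -mulNr opprB.
have := normsq_1Bcis (N%:R * (w * x)).
rewrite -geo Normc.normcM exprMn normsq_1Bcis -/(S x).
have := @cos_geN1 R (N%:R * (w * x)); nra.
Qed.

Let cS : continuous S.
Proof. by rewrite (funext SE); exact: continuous_sum_cos. Qed.

Let cS2 : continuous (fun x => S x ^+ 2).
Proof. by rewrite (funext S2E); exact: continuous_sum_cos. Qed.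

Let int_S a : itvI a (a + K) S = N%:R * K.
Proof.
rewrite (funext SE).
rewrite itvI_sum; last by move=> p; exact: continuous_cosM.
rewrite -(pair_bigA _ (fun a b : 'I_N => itvI _ _ (fun x => cos ((a%:Z - b%:Z)%:~R * w * x))))/=.
under eq_bigr => b _.
  rewrite (bigD1 b)//= itvI_cos// subrr eqxx big1 ?addr0; last first.
    move=> c cb; rewrite itvI_cos// subr_eq0.
    case: eqP => // -[bc]; by move: cb; rewrite (val_inj bc) eqxx.
  over.
by rewrite sumr_const card_ord mulr_natl.
Qed.

Let int_S2 a : itvI a (a + K) (fun x => S x ^+ 2) = C.
Proof.
rewrite (funext S2E).
rewrite itvI_sum; last by move=> p; exact: continuous_cosM.
rewrite /C /coincidence mulr_sumr; apply: eq_bigr => p _.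
by rewrite itvI_cos// subr_eq0 eqz_nat; case: eqP; rewrite ?mulr1 ?mulr0.
Qed.

Let N0r : 0 < N%:R :> R. Proof. by rewrite ltr0n. Qed.

Let C_ge : K * (N%:R ^+ 3 / 2) <= C.
Proof. by rewrite /C ler_pM2l// coincidence_ge. Qed.

Let C0 : 0 < C.
Proof. by apply: lt_le_trans C_ge; rewrite mulr_gt0// divr_gt0// exprn_gt0. Qed.

(** The mass of [S ^+ 2] over a period is [K] times the number of coincidences,
    hence at least [K N ^ 3 / 2], whereas [S ^+ 2 * (1 - cos)] is at most [2 S],
    of mass [2 N K].  So the second moment of [g] is [O(K ^ 2 / N ^ 2)] and the
    first is [O(K / N)].  There are [N ^ 4] coefficients, all equal to the inverse
    of the mass. *)
Lemma jackson_kernel : exists (g : R -> R) (r : seq (R * R)),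
  [/\ quad_kernel K (2 * K / N%:R) g,
     \sum_(p <- r) `|p.1| <= 2 * N%:R / K &
     forall x, ((g x)%:C)%C = \sum_(p <- r) (p.1%:C)%C * cis (p.2 * x)].
Proof.
exists g, [seq (C^-1, ((p.1.1 + p.1.2)%N%:Z - (p.2.1 + p.2.2)%N%:Z)%:~R * w)
  | p : ('I_N * 'I_N) * ('I_N * 'I_N)].
have cg : continuous g.
  by move=> x; apply: cvgM; [exact: cvg_cst|exact: cS2].
have g0 x : 0 <= g x by rewrite mulr_ge0 ?sqr_ge0// invr_ge0 ltW.
have ig a : itvI a (a + K) g = 1 by rewrite /g itvIZ// int_S2 mulVf// gt_eqF.
split => //; first split => //.
- move=> k.
  (* The first moment is bounded through the second one by
     |y| <= eta / 2 + y ^+ 2 / (2 * eta), with eta of the expected size. *)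
  pose eta := 2 * K / N%:R.
  have eta0 : 0 < eta by rewrite divr_gt0// mulr_gt0.
  have abs_le x : k%:R * K - K / 2 <= x <= k%:R * K + K / 2 ->
      g x * `|x - k%:R * K| <= eta / 2 * g x + K ^+ 2 / (2 * eta) * (2 / C) * S x.
    move=> xk.
    have cosE : cos (w * (x - k%:R * K)) = cos (w * x).
      have -> : w * (x - k%:R * K) = w * x - pi *+ 2 *+ k.
        rewrite mulrBr; congr (_ - _); rewrite /w -[RHS]mulr_natr -[pi *+ 2]mulr_natr; field.
        by rewrite gt_eqF.
      by rewrite -[LHS](periodicn (@cosD2pi R) k) subrK.
    have sq : (x - k%:R * K) ^+ 2 <= K ^+ 2 * (1 - cos (w * x)).
      rewrite -cosE; set t := x - _.
      have p2 := @pi_ge2 R.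
      have wK : w * K = 2 * pi by rewrite /w divfK// gt_eqF.
      have w0 : 0 < w by rewrite divr_gt0// mulr_gt0// pi_gt0.
      have tK : `|t| <= K / 2 by rewrite /t ler_distl.
      have : `|w * t| <= pi.
        rewrite normrM (gtr0_norm w0).
        by have -> : pi = w * (K / 2) :> R; [rewrite mulrA wK; field | rewrite ler_pM2l].
      move=> /one_sub_cos_ge H.
      apply: (@le_trans _ _ (K ^+ 2 * ((w * t) ^+ 2 / 8))); last by rewrite ler_wpM2l ?sqr_ge0.
      have -> : K ^+ 2 * ((w * t) ^+ 2 / 8) = (w * K) ^+ 2 / 8 * t ^+ 2 by field.
      rewrite wK ler_peMl ?sqr_ge0//; nra.
    have ab : `|x - k%:R * K| <= eta / 2 + (x - k%:R * K) ^+ 2 / (2 * eta).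
      rewrite -(real_normK (num_real (x - _))); set t := `|_|.
      have -> : eta / 2 + t ^+ 2 / (2 * eta) = t + (t - eta) ^+ 2 / (2 * eta).
        by field; rewrite gt_eqF.
      by rewrite lerDl divr_ge0 ?sqr_ge0// mulr_ge0// ltW.
    apply: (le_trans (ler_wpM2l (g0 x) ab)).
    rewrite mulrDr [g x * (eta / 2)]mulrC lerD2l.
    apply: (@le_trans _ _ (g x * (K ^+ 2 * (1 - cos (w * x)) / (2 * eta)))).
      by rewrite ler_wpM2l// ler_wpM2r// invr_ge0 mulr_ge0// ltW.
    have -> : g x * (K ^+ 2 * (1 - cos (w * x)) / (2 * eta)) =
        K ^+ 2 / (2 * eta) * (C^-1 * S x) * (S x * (1 - cos (w * x))).
      by rewrite /g; ring.
    have -> : K ^+ 2 / (2 * eta) * (2 / C) * S x = K ^+ 2 / (2 * eta) * (C^-1 * S x) * 2.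
      by ring.
    rewrite ler_wpM2l//; apply: mulr_ge0; last by rewrite mulr_ge0// invr_ge0 ltW.
    by rewrite divr_ge0 ?sqr_ge0// mulr_ge0// ltW.
  apply: (@le_trans _ _ (itvI (k%:R * K - K / 2) (k%:R * K + K / 2)
    (fun x => eta / 2 * g x + K ^+ 2 / (2 * eta) * (2 / C) * S x))).
    apply: itvI_le => //.
    + move=> x; apply: cvgM; first exact: cg.
      by apply: cvg_norm; apply: cvgB; [exact: cvg_id|exact: cvg_cst].
    + move=> x; apply: cvgD; (apply: cvgM; first exact: cvg_cst); [exact: cg|exact: cS].
  have -> : k%:R * K + K / 2 = k%:R * K - K / 2 + K by field.
  rewrite itvID; last 2 first.
  + by move=> x; apply: cvgM; [exact: cvg_cst|exact: cg].
  + by move=> x; apply: cvgM; [exact: cvg_cst|exact: cS].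
  rewrite (itvIZ _ _ _ cg) (itvIZ _ _ _ cS) ig int_S mulr1.
  have -> : K ^+ 2 / (2 * eta) * (2 / C) * (N%:R * K) = (N%:R ^+ 2 * K ^+ 2 / 2) / C.
    by rewrite /eta; field; rewrite !gt_eqF.
  have -> : 2 * K / N%:R = eta / 2 + K / N%:R by rewrite /eta; field; rewrite gt_eqF.
  rewrite lerD2l ler_pdivrMr//.
  have -> : N%:R ^+ 2 * K ^+ 2 / 2 = K / N%:R * (K * (N%:R ^+ 3 / 2)) by field; rewrite gt_eqF.
  by rewrite ler_wpM2l// divr_ge0// ltW.
- rewrite big_image/= sumr_const !card_prod !card_ord ger0_norm ?invr_ge0 ?(ltW C0)//.
  rewrite -[leLHS]mulr_natr mulrC ler_pdivrMr// !natrM.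
  have -> : N%:R * N%:R * (N%:R * N%:R) = 2 * N%:R / K * (K * (N%:R ^+ 3 / 2)) :> R.
    by field; rewrite gt_eqF.
  by rewrite ler_wpM2l// divr_ge0 ?(ltW K0)// mulr_ge0.
- move=> x; rewrite big_image/= /g -mulr_sumr rmorphM/= S2cE.
  by [].
Qed.
End JacksonKernel.
End Jackson.

(** * Quadrature against periodic kernels *)

(** The nodes are the [n0 + 1] multiples of [K] in [0, T]. *)
Section Quadrature1.
Context {R : realType}.
Variables (K T delta : R) (g : R -> R).
Hypotheses (K0 : 0 < K) (KT : K <= T) (qg : quad_kernel K delta g).

Let n0 := Num.truncn (T / K).

Let cg : continuous g. Proof. by case: qg. Qed.
Let g0 x : 0 <= g x. Proof. by case: qg => _ + _ _; exact. Qed.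
Let g1 a : itvI a (a + K) g = 1. Proof. by case: qg => _ _ + _; exact. Qed.
Let T0 : 0 < T. Proof. exact: lt_le_trans KT. Qed.

Lemma truncn_bounds : n0%:R * K <= T < n0%:R * K + K.
Proof.
have /andP[nl nu] : n0%:R <= T / K < n0.+1%:R by apply: truncn_itv; rewrite divr_ge0// ltW.
rewrite -ler_pdivlMr// nl/= -[X in _ + X]mul1r -mulrDl natr1.
by rewrite -ltr_pdivrMr.
Qed.

Lemma truncnS_le : n0.+1%:R <= 2 * T / K.
Proof.
have /andP[nK _] := truncn_bounds.
rewrite ler_pdivlMr// -[n0.+1%:R]natr1 mulrDl mul1r.
by rewrite mulrDl mul1r lerD.
Qed.

Lemma itvI_kernel_le1 a b : a <= b -> b <= a + K -> itvI a b g <= 1.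
Proof.
move=> ab bK; rewrite -(g1 a) (itvI_chasles cg ab bK) lerDl.
by apply: Rintegral_ge0.
Qed.

Lemma itvI_kernel_T : itvI 0 T g <= 2 * T / K.
Proof.
have E n : itvI 0 (n%:R * K) g = n%:R.
  elim: n => [|n IH]; first by rewrite mul0r /itvI set_itv1 Rintegral_set1.
  have nK : 0 <= n%:R * K by rewrite mulr_ge0// ltW.
  have -> : n.+1%:R * K = n%:R * K + K by rewrite -natr1 mulrDl mul1r.
  by rewrite (itvI_chasles cg nK) ?lerDl ?ltW// IH g1 natr1.
have /andP[_ Tn] := truncn_bounds.
apply: le_trans truncnS_le; rewrite -(E n0.+1).
have -> : n0.+1%:R * K = n0%:R * K + K by rewrite -natr1 mulrDl mul1r.
rewrite (itvI_chasles cg (ltW T0) (ltW Tn)) lerDl.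
by apply: Rintegral_ge0.
Qed.

Variables (phi : R -> R) (L M : R).
Hypotheses (L0 : 0 <= L) (phiL : forall x y, `|phi x - phi y| <= L * `|x - y|).
Hypotheses (phiM : forall x, `|phi x| <= M).

Lemma lipschitz_continuous : continuous phi.
Proof.
have L1 : 0 < L + 1 by rewrite ltr_wpDl.
move=> x; apply/cvgrPdist_le => e e0.
have idx : (fun y : R => y) y @[y --> x] --> x by exact: cvg_id.
have /cvgrPdist_le/(_ _ (divr_gt0 e0 L1)) nx := idx.
near=> y; rewrite (le_trans (phiL _ _))//.
apply: (@le_trans _ _ ((L + 1) * `|x - y|)).
  by rewrite ler_wpM2r// lerDl.
by rewrite mulrC -ler_pdivlMr//; near: y.
Unshelve. all: by end_near.
Qed.

Let cphi := lipschitz_continuous.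

Let cgphi : continuous (fun x => g x * phi x).
Proof. by move=> x; apply: cvgM; [exact: cg|exact: cphi]. Qed.

Let short a b : a <= b -> b <= a + K -> `|itvI a b (fun x => g x * phi x)| <= M.
Proof.
move=> ab bK; apply: (le_trans (itvI_norm _ _ cgphi)).
apply: (@le_trans _ _ (itvI a b (fun x => M * g x))).
  apply: itvI_le.
  - by move=> x; apply: cvg_norm; exact: cgphi.
  - by move=> x; apply: cvgM; [exact: cvg_cst|exact: cg].
  - by move=> x _; rewrite normrM (ger0_norm (g0 x)) mulrC ler_wpM2r.
rewrite itvIZ// -[leRHS]mulr1 ler_wpM2l ?itvI_kernel_le1//.
exact: le_trans (phiM 0).
Qed.

Let cell (k : nat) : `|itvI (k%:R * K - K / 2) (k%:R * K + K / 2) (fun x => g x * phi x)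
  - phi (k%:R * K)| <= L * delta.
Proof.
set a := k%:R * K - K / 2; set b := k%:R * K + K / 2.
have bE : b = a + K by rewrite /a /b; field.
have cc : continuous (fun x => phi (k%:R * K) * g x).
  by move=> x; apply: cvgM; [exact: cvg_cst|exact: cg].
have -> : phi (k%:R * K) = itvI a b (fun x => phi (k%:R * K) * g x).
  by rewrite itvIZ// bE g1 mulr1.
rewrite -itvIB//; apply: (le_trans (itvI_norm _ _ _)).
  by move=> x; apply: cvgB; [exact: cgphi|exact: cc].
have cd : continuous (fun x => g x * `|x - k%:R * K|).
  move=> x; apply: cvgM; first exact: cg.
  by apply: cvg_norm; apply: cvgB; [exact: cvg_id|exact: cvg_cst].
apply: (@le_trans _ _ (itvI a b (fun x => L * (g x * `|x - k%:R * K|)))).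
  apply: itvI_le.
  - by move=> x; apply: cvg_norm; apply: cvgB; [exact: cgphi|exact: cc].
  - by move=> x; apply: cvgM; [exact: cvg_cst|exact: cd].
  - move=> x _; rewrite [_ * g x]mulrC -mulrBr normrM (ger0_norm (g0 x)) mulrCA.
    by rewrite ler_wpM2l.
rewrite itvIZ// ler_wpM2l//.
by case: qg => _ _ _; exact.
Qed.

(** The interval [0, T] is replaced by the union of the cells of width [K]
    centred at the nodes; this changes the integral at both ends over a piece
    shorter than a period, that is by at most [M] each.  On a cell, [g * phi]
    integrates to [phi (k K)] up to [L] times the first moment of [g].  There are
    at most [2 T / K] cells. *)
Lemma quadrature1 :
  `|itvI 0 T (fun x => g x * phi x) - \sum_(0 <= k < n0.+1) phi (k%:R * K)|
  <= 2 * T / K * (L * delta + K / T * M).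
Proof.
have K2 : 0 < K / 2 by rewrite divr_gt0.
have /andP[nT Tn] := truncn_bounds.
set b := n0%:R * K + K / 2.
have b0 : 0 <= b by rewrite addr_ge0 ?(ltW K2)// mulr_ge0// ltW.
have P n : itvI (- (K / 2)) (n%:R * K + K / 2) (fun x => g x * phi x) =
    \sum_(0 <= k < n.+1) itvI (k%:R * K - K / 2) (k%:R * K + K / 2) (fun x => g x * phi x).
  elim: n => [|n IH]; first by rewrite big_nat1 mul0r add0r sub0r.
  rewrite big_nat_recr//= -IH.
  have E : n.+1%:R * K - K / 2 = n%:R * K + K / 2 by rewrite -natr1; field.
  have nK : 0 <= n%:R * K by rewrite mulr_ge0// ltW.
  rewrite E -itvI_chasles//; first by move: K2 nK; set u := _ / _; set v := _ * _; lra.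
  by rewrite -[n.+1%:R]natr1 mulrDl mul1r; lra.
have E1 : `|itvI (- (K / 2)) b (fun x => g x * phi x) - \sum_(0 <= k < n0.+1) phi (k%:R * K)|
    <= n0.+1%:R * (L * delta).
  rewrite P -sumrB (le_trans (ler_norm_sum _ _ _))//.
  apply: (@le_trans _ _ (\sum_(0 <= k < n0.+1) (L * delta))).
    by apply: ler_sum => k _; exact: cell.
  by rewrite sumr_const_nat subn0 mulr_natl.
have E2 : `|itvI 0 T (fun x => g x * phi x) - itvI (- (K / 2)) b (fun x => g x * phi x)| <= 2 * M.
  have mK2 : - (K / 2) <= 0 by rewrite oppr_le0 ltW.
  rewrite (itvI_chasles cgphi mK2 b0) opprD addrCA.
  apply: (le_trans (ler_normD _ _)); rewrite normrN.
  have -> : 2 * M = M + M by ring.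
  apply: lerD; first by apply: short => //; lra.
  have [Tb|bT] := leP T b.
    rewrite (itvI_chasles cgphi (ltW T0) Tb) opprD addrA subrr sub0r normrN.
    by apply: short => //; rewrite /b; lra.
  rewrite (itvI_chasles cgphi b0 (ltW bT)) addrC addKr.
  by apply: short; [exact: ltW|rewrite /b; lra].
have Ld : 0 <= L * delta by apply: le_trans (cell 0).
have E3 : n0.+1%:R * (L * delta) <= 2 * T / K * (L * delta) by rewrite ler_wpM2r// truncnS_le.
have -> : 2 * T / K * (L * delta + K / T * M) = 2 * T / K * (L * delta) + 2 * M.
  by field; rewrite !gt_eqF.
set I := itvI 0 T _ in E2 *; set J := itvI _ b _ in E1 E2.
rewrite -(subrKA J) addrC (le_trans (ler_normD _ _))// lerD//.
exact: le_trans E3.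
Qed.
End Quadrature1.

Section Quadrature.
Context {R : realType}.
Local Notation RM := (measurableTypeR R).

(** A sequence defined by recursion on the dimension, like [lebesgue_tuple], so
    that sums over nodes split in the same way as integrals over the box. *)
Fixpoint grid d : ('I_d -> nat) -> seq (d.-tuple nat) :=
  match d with
  | 0 => fun _ => [:: [tuple]]
  | d'.+1 => fun n =>
      [seq ([tuple of k :: t] : d'.+1.-tuple nat) | k : nat <- iota 0 (n ord0).+1,
         t : d'.-tuple nat <- grid (fun i => n (lift ord0 i))]
  end.

Lemma gridS d (n : 'I_d.+1 -> nat) : grid n =
  [seq ([tuple of k :: t] : d.+1.-tuple nat) | k : nat <- iota 0 (n ord0).+1,
     t : d.-tuple nat <- grid (fun i => n (lift ord0 i))].
Proof. by []. Qed.

Definition node d (K : 'I_d -> R) (k : d.-tuple nat) : d.-tuple R :=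
  [tuple (tnth k i)%:R * K i | i < d].

Lemma node_cons d (K : 'I_d.+1 -> R) (k : nat) (t : d.-tuple nat) :
  node K [tuple of k :: t] = [tuple of k%:R * K ord0 :: node (fun i => K (lift ord0 i)) t].
Proof.
apply: eq_from_tnth => i; rewrite tnth_mktuple.
by case: (unliftP ord0 i) => [j ->|->]; rewrite ?tnth0 ?tnthS ?tnth_mktuple.
Qed.

Lemma sum_grid d (n : 'I_d.+1 -> nat) (F : d.+1.-tuple nat -> R) :
  \sum_(k <- grid n) F k = \sum_(0 <= k < (n ord0).+1)
     \sum_(t <- grid (fun i => n (lift ord0 i))) F [tuple of k :: t].
Proof.
rewrite gridS.
by rewrite big_allpairs_dep /index_iota subn0.
Qed.

Lemma sum_grid_const d (n : 'I_d -> nat) (c : R) :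
  \sum_(k <- grid n) c = (\prod_(i < d) (n i).+1%:R) * c.
Proof.
elim: d n c => [|d IH] n c; first by rewrite /= big_seq1 big_ord0 mul1r.
rewrite sum_grid big_ord_recl/= -mulrA -IH.
by rewrite sumr_const_nat subn0 mulr_natl.
Qed.

(** Induction on the dimension.  The integral over the last coordinates is
    replaced by a sum over nodes, with an error multiplied by the mass of
    [g ord0] on [0, T]; then [quadrature1] applies to the first coordinate, once
    for each node in the last ones. *)
Lemma quadrature d (K : 'I_d -> R) (T delta L M G : R) (g : 'I_d -> R -> R)
    (F : d.-tuple R -> R) : 0 < T ->
  (forall i, 0 < K i <= T) -> (forall i, quad_kernel (K i) delta (g i)) ->
  (forall i x, `|g i x| <= G) -> 0 <= L ->
  (forall s t, `|F s - F t| <= L * \sum_(i < d) `|tnth s i - tnth t i|) ->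
  (forall t, `|F t| <= M) ->
  `|\int[lebesgue_tuple d]_(t in tbox d T) ((\prod_(i < d) g i (tnth t i)) * F t)
    - \sum_(k <- grid (fun i => Num.truncn (T / K i))) F (node K k)|
  <= (\prod_(i < d) (2 * T / K i)) * \sum_(i < d) (L * delta + K i / T * M).
Proof.
move=> T0; elim: d K g F => [|d IH] K g F hK hg hG L0 FL FM.
  rewrite !big_ord0 mulr0 /= big_seq1.
  rewrite (_ : tbox 0 T = setT); last by apply/seteqP; split => // t _ -[].
  rewrite /Rintegral integral_dirac//=; last first.
    apply/measurable_EFinP; under eq_fun do rewrite big_ord0 mul1r.
    exact: (lipschitz_measurable L0 FL).
  rewrite indicE in_setT mul1r big_ord0 mul1r /=.
  rewrite (_ : node K [tuple] = [tuple]) ?subrr ?normr0//.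
  exact: tuple0.
have [K0 K0T] := andP (hK ord0).
pose K' i := K (lift ord0 i); pose g' i := g (lift ord0 i).
pose Fx x (t : d.-tuple R) := F [tuple of x :: t].
pose gr := grid (fun i => Num.truncn (T / K' i)).
pose Eprod := \prod_(i < d) (2 * T / K' i).
pose Ed := Eprod * \sum_(i < d) (L * delta + K' i / T * M).
have FxL x s t : `|Fx x s - Fx x t| <= L * \sum_(i < d) `|tnth s i - tnth t i|.
  apply: (le_trans (FL _ _)); rewrite big_ord_recl !tnth0 subrr normr0 add0r.
  by under eq_bigr do rewrite !tnthS.
have FtL t x y : `|Fx x t - Fx y t| <= L * `|x - y|.
  apply: (le_trans (FL _ _)); rewrite big_ord_recl !tnth0 big1 ?addr0// => i _.
  by rewrite !tnthS subrr normr0.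
have IHx x := IH K' g' (Fx x) (fun i => hK _) (fun i => hg _) (fun i => hG _) L0
  (FxL x) (fun t => FM _).
pose Phi x := \int[lebesgue_tuple d]_(t in tbox d T) ((\prod_(i < d) g' i (tnth t i)) * Fx x t).
pose Psi x := \sum_(k <- gr) Fx x (node K' k).
have PP x : `|Phi x - Psi x| <= Ed := IHx x.
have mg e (kk : 'I_e -> R) (gg : 'I_e -> R -> R) : (forall i, quad_kernel (kk i) delta (gg i)) ->
    measurable_fun setT (fun t : e.-tuple RM => \prod_(i < e) gg i (tnth t i)).
  move=> hgg; apply: measurable_prod => i _.
  apply: measurableT_comp; last exact: measurable_tnth.
  by apply: continuous_measurable_fun; case: (hgg i).
have gprod e (gg : 'I_e -> R -> R) : (forall i x, `|gg i x| <= G) ->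
    forall t : e.-tuple R, `|\prod_(i < e) gg i (tnth t i)| <= G ^+ e.
  move=> hgg t; rewrite normr_prod.
  rewrite -[X in G ^+ X]card_ord -prodr_const; apply: ler_prod => i _.
  by rewrite normr_ge0 hgg.
pose h (t : d.+1.-tuple RM) := (\prod_(i < d.+1) g i (tnth t i)) * F t.
have mh : measurable_fun setT h.
  apply: measurable_funM; first exact: (mg _ K).
  exact: (lipschitz_measurable L0 FL).
have hM t : `|h t| <= G ^+ d.+1 * M by rewrite normrM ler_pM// gprod.
have [ih ->] := integral_tbox_recl T mh hM.
have hx x : \int[lebesgue_tuple d]_(t in tbox d T) h (tuple_consp (x, t)) = g ord0 x * Phi x.
  rewrite /Phi -RintegralZl; last 2 first.
  - exact: measurable_tbox.
  - apply: (@tbox_integrable _ _ _ (G ^+ d * M)).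
      apply: measurable_funM; first exact: (mg d K' g' (fun i => hg _)).
      exact: (lipschitz_measurable L0 (FxL x)).
    move=> t _; rewrite normrM.
    exact: (ler_pM (normr_ge0 _) (normr_ge0 _) (gprod d g' (fun i y => hG _ _) t) (FM _)).
  apply: eq_Rintegral => t _; rewrite /h big_ord_recl tnth0 -mulrA; congr (_ * (_ * _)).
  by apply: eq_bigr => i _; rewrite tnthS.
have hxE : (fun x => \int[lebesgue_tuple d]_(t in tbox d T) h (tuple_consp (x, t))) =
   (fun x => g ord0 x * Phi x) by apply/funext.
rewrite hxE in ih *.
have cg : continuous (g ord0) by case: (hg ord0).
have cFx t : continuous (fun x => Fx x t) := lipschitz_continuous L0 (FtL t).
have cPsi : continuous Psi by apply: continuous_sumr => k; exact: cFx.
have cgPsi : continuous (fun x => g ord0 x * Psi x).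
  by move=> x; apply: cvgM; [exact: cg|exact: cPsi].
have iPsi := itvI_integrable 0 T cgPsi.
have A : `|itvI 0 T (fun x => g ord0 x * Phi x) - itvI 0 T (fun x => g ord0 x * Psi x)|
    <= 2 * T / K ord0 * Ed.
  have iB : (@lebesgue_measure R).-integrable `[0, T]
      (EFin \o (fun x => g ord0 x * Phi x - g ord0 x * Psi x)).
    have iPsi' : (@lebesgue_measure R).-integrable (`[0, T]%classic : set RM)
        (EFin \o (fun x : RM => g ord0 x * Psi x)) by exact: iPsi.
    have mI : measurable (`[0, T]%classic : set RM) by exact: measurable_itv.
    exact: (integrableB mI ih iPsi').
  rewrite -RintegralB//.
  apply: (le_trans (le_normr_Rintegral _ iB)) => //.
  apply: (@le_trans _ _ (itvI 0 T (fun x => Ed * g ord0 x))); last first.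
    rewrite itvIZ// mulrC ler_wpM2r//; last exact: (itvI_kernel_T K0 K0T (hg _)).
    exact: le_trans (PP 0).
  apply: le_Rintegral => //.
  - exact: (integrable_norm iB).
  - by apply: itvI_integrable => x; apply: cvgM; [exact: cvg_cst|exact: cg].
  - move=> x _; rewrite /= -mulrBr normrM ger0_norm ?[_ * g _ _]mulrC ?ler_wpM2l//.
    + by case: (hg ord0).
    + by case: (hg ord0).
have Bq : `|itvI 0 T (fun x => g ord0 x * Psi x) -
     \sum_(k <- grid (fun i => Num.truncn (T / K i))) F (node K k)|
    <= Eprod * (2 * T / K ord0 * (L * delta + K ord0 / T * M)).
  have -> : (fun x => g ord0 x * Psi x) = fun x => \sum_(k <- gr) g ord0 x * Fx x (node K' k).
    by apply/funext => x; rewrite mulr_sumr.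
  rewrite itvI_sum; last by move=> k x; apply: cvgM; [exact: cg|exact: cFx].
  rewrite sum_grid exchange_big/= -/gr -sumrB (le_trans (ler_norm_sum _ _ _))//.
  set e1 := 2 * T / K ord0 * _.
  have q1 t := @quadrature1 R _ _ _ _ K0 K0T (hg ord0) (fun x => Fx x t) L M L0 (FtL t)
      (fun x => FM _).
  apply: (@le_trans _ _ (\sum_(k <- gr) e1)).
    apply: ler_sum => k _.
    rewrite (eq_bigr (fun i : nat => Fx (i%:R * K ord0) (node K' k))); first exact: q1.
    by move=> i _; rewrite node_cons.
  rewrite sum_grid_const; apply: ler_wpM2r; last first.
    apply: ler_prod => i _; rewrite ler0n/=.
    have [Ki KiT] := andP (hK (lift ord0 i)).
    exact: truncnS_le.
  exact: le_trans (q1 [tuple 0 | i < d]).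
rewrite big_ord_recl [\sum_(i < d.+1) _]big_ord_recl -/Eprod.
rewrite -(subrKA (itvI 0 T (fun x => g ord0 x * Psi x))) (le_trans (ler_normD _ _))//.
apply: (le_trans (lerD A Bq)).
rewrite /Ed; set s := \sum_(i < d) (L * delta + K' i / T * M).
by rewrite le_eqVlt; apply/orP; left; apply/eqP; ring.
Qed.

(** With [a i = T / K i] and [x i] the number of multiples of [K i] in [0, T],
    this compares the number of nodes with the volume divided by [|K|]. *)
Lemma prod_near d (a x : 'I_d -> R) :
  (forall i, 1 <= a i) -> (forall i, a i <= x i <= a i + 1) ->
  `|\prod_(i < d) x i - \prod_(i < d) a i| <= (\prod_(i < d) (2 * a i)) * \sum_(i < d) (a i)^-1.
Proof.
move=> a1 ax.
have a0 i : 0 < a i := lt_le_trans ltr01 (a1 i).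
have H : 0 <= \prod_(i < d) x i - \prod_(i < d) a i
    <= (\prod_(i < d) (2 * a i)) * \sum_(i < d) (a i)^-1; last first.
  by have /andP[h1 h2] := H; rewrite ger0_norm.
elim: d a x a1 ax a0 => [|d IH] a x a1 ax a0; first by rewrite !big_ord0 mulr0 subrr lexx.
rewrite !big_ord_recl.
have := IH (fun i => a (lift ord0 i)) (fun i => x (lift ord0 i))
  (fun i => a1 _) (fun i => ax _) (fun i => a0 _).
set X := \prod_(i < d) x _; set A := \prod_(i < d) a _.
set P := \prod_(i < d) _; set S := \sum_(i < d) _ => /andP[h1 h2].
have A0 : 0 <= A by apply: prodr_ge0 => i _; exact: ltW.
have AP : A <= P.
  apply: ler_prod => i _; rewrite (ltW (a0 _))/= ler_peMl ?(ltW (a0 _))//.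
  by rewrite ler1n.
have P0 : 0 <= P := le_trans A0 AP.
have S0 : 0 <= S by apply: sumr_ge0 => i _; rewrite invr_ge0 ltW.
have /andP[x1 x2] := ax ord0; have := a1 ord0; have := a0 ord0.
move: x1 x2; set x0 := x ord0; set b := a ord0 => x1 x2 b0 b1.
have -> : x0 * X - b * A = x0 * (X - A) + (x0 - b) * A by ring.
have -> : 2 * b * P * (b^-1 + S) = 2 * b * (P * S) + 2 * P by field; rewrite gt_eqF.
apply/andP; split.
  by rewrite addr_ge0// mulr_ge0// ?subr_ge0// (le_trans (ltW b0)).
apply: lerD.
  by apply: ler_pM => //; lra.
by apply: ler_pM => //; lra.
Qed.
End Quadrature.

(** * Lattice points in the box and twisted averages *)

Section OrbitSum.
Context {R : realType}.

Lemma mem_grid d (n : 'I_d -> nat) (k : d.-tuple nat) :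
  (k \in grid n) = [forall i, (tnth k i <= n i)%N].
Proof.
elim: d n k => [|d IH] n k.
  by rewrite tuple0 inE eqxx; apply/esym/forallP => -[].
rewrite gridS.
case/tupleP: k => x l.
apply/allpairsP/forallP => [[[j t]] []|kn].
  rewrite mem_iota /= add0n ltnS => jn; rewrite IH => /forallP tn /(congr1 val) /= [xj lt] i.
  case: (unliftP ord0 i) => [h ->|->]; last by rewrite tnth0 xj.
  by rewrite tnthS (val_inj lt); exact: tn.
exists (x, l); split => //.
- by rewrite mem_iota add0n ltnS; have := kn ord0; rewrite tnth0.
- by rewrite IH; apply/forallP => i; have := kn (lift ord0 i); rewrite tnthS.
Qed.

Lemma grid_uniq d (n : 'I_d -> nat) : uniq (grid n).
Proof.
elim: d n => [|d IH] n //.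
rewrite gridS.
apply: allpairs_uniq => //; first exact: iota_uniq.
by move=> [j t] [j' t'] _ _ /= /(congr1 val) /= [-> /val_inj ->].
Qed.

Definition ffun_of d (k : d.-tuple nat) : {ffun 'I_d -> int} := [ffun i => (tnth k i)%:Z].

Lemma ffun_of_inj d : injective (@ffun_of d).
Proof.
move=> k l /ffunP kl; apply: eq_from_tnth => i.
by have := kl i; rewrite !ffunE => -[].
Qed.

Lemma orbit_sum_grid n d (u : ('I_d -> R) -> SL R n) (g0 : SL R n) (K : 'I_d -> R) (T : R)
    (f : X R n -> R[i]) : 0 < T -> (forall i, 0 < K i) ->
  orbit_sum u g0 K T f = \sum_(k <- grid (fun i => Num.truncn (T / K i)))
    f (actX (piX g0) (u (tnth (node K k)))).
Proof.
move=> T0 K0; rewrite /orbit_sum.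
have -> : [set k : {ffun 'I_d -> int} | box T (Kvec K k)] =
    [set` [seq ffun_of k | k <- grid (fun i => Num.truncn (T / K i))]].
  apply/seteqP; split => k /=.
    move=> bk.
    have k0 i : 0 <= k i.
      by have /andP[+ _] := bk i; rewrite /Kvec pmulr_rge0// ler0z.
    apply/mapP; exists [tuple `|k i|%N | i < d]; last first.
      by apply/ffunP => i; rewrite ffunE tnth_mktuple gez0_abs.
    rewrite mem_grid; apply/forallP => i; rewrite tnth_mktuple.
    rewrite truncn_ge_nat ?divr_ge0 ?(ltW T0) ?(ltW (K0 i))// ler_pdivlMr//.
    have /andP[_] := bk i; rewrite /Kvec mulrC.
    by rewrite -{1}(gez0_abs (k0 i)) -pmulrn.
  move=> /mapP[l + ->]; rewrite mem_grid => /forallP ln i.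
  rewrite /Kvec ffunE -pmulrn; apply/andP; split; first by rewrite mulr_ge0// ltW.
  have := ln i; rewrite truncn_ge_nat ?divr_ge0 ?(ltW T0) ?(ltW (K0 i))// ler_pdivlMr//.
  by rewrite mulrC.
rewrite -fsbig_seq; last by rewrite map_inj_uniq ?grid_uniq//; exact: ffun_of_inj.
rewrite big_map; apply: eq_bigr => k _; congr (f (actX _ (u _))).
by apply/funext => i; rewrite /Kvec ffunE tnth_mktuple mulrC.
Qed.

End OrbitSum.

Section Twist.
Context {R : realType}.
Local Notation RM := (measurableTypeR R).

Lemma add_charE d (a t : 'I_d -> R) : add_char a t = cis (\sum_(i < d) a i * t i).
Proof. by []. Qed.

(** Stated for a product over a sequence of indices for the sake of the
    induction, in which the coordinate [i] of the frequencies is filled in. *)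
Lemma tensor_expansion d (g : 'I_d -> R -> R) (A : 'I_d -> R) (s : seq 'I_d) :
  (forall i, exists r : seq (R * R), \sum_(p <- r) `|p.1| <= A i /\
    forall x, ((g i x)%:C)%C = \sum_(p <- r) (p.1%:C)%C * cis (p.2 * x)) ->
  exists r : seq (R * ('I_d -> R)), \sum_(p <- r) `|p.1| <= \prod_(i <- s) A i /\
    forall t : 'I_d -> R, ((\prod_(i <- s) g i (t i))%:C)%C =
      \sum_(p <- r) (p.1%:C)%C * add_char p.2 t.
Proof.
move=> hg; elim: s => [|i s [r [rA rE]]].
  exists [:: (1, fun=> 0)]; split; first by rewrite big_seq1 big_nil normr1.
  move=> t; rewrite big_nil big_seq1 add_charE big1 ?cis0 ?mulr1// => i _.
  by rewrite mul0r.
have [q [qA qE]] := hg i.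
exists [seq (p.1 * p'.1, fun j => (if j == i then p.2 else 0) + p'.2 j) | p <- q, p' <- r]; split.
  rewrite big_allpairs_dep big_cons/=.
  apply: (@le_trans _ _ ((\sum_(p <- q) `|p.1|) * (\sum_(p <- r) `|p.1|))).
    rewrite big_distrlr/=; apply: ler_sum => p _; apply: ler_sum => p' _.
    by rewrite normrM.
  by apply: ler_pM => //; apply: sumr_ge0.
move=> t; rewrite big_cons rmorphM/= qE rE big_distrlr/= big_allpairs_dep/=.
apply: eq_bigr => p _; apply: eq_bigr => p' _.
rewrite rmorphM/= mulrACA; congr (_ * _).
rewrite !add_charE -cisD; congr cis.
under [RHS]eq_bigr do rewrite mulrDl.
rewrite big_split/=; congr (_ + _).
rewrite (bigD1 i)//= eqxx big1 ?addr0// => j /negbTE ->.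
by rewrite mul0r.
Qed.

Variables (d : nat) (T E M : R) (F : ('I_d -> R) -> R[i]).
Hypotheses (T0 : 0 < T).
Let Fr (t : d.-tuple RM) := complex.Re (F (tnth t)).
Let Fi (t : d.-tuple RM) := complex.Im (F (tnth t)).
Hypotheses (mFr : measurable_fun setT Fr) (mFi : measurable_fun setT Fi).
Hypotheses (FrM : forall t, `|Fr t| <= M) (FiM : forall t, `|Fi t| <= M).
Hypothesis hE : forall a, Normc.normc (box_average T (fun t => add_char a t * F t)) <= E.

Lemma measurable_phase (a : 'I_d -> R) :
  measurable_fun setT (fun t : d.-tuple RM => \sum_(i < d) a i * tnth t i).
Proof.
apply: measurable_sum => i; apply: measurable_funM; first exact: measurable_cst.
exact: measurable_tnth.
Qed.

Lemma measurable_cos_phase (a : 'I_d -> R) :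
  measurable_fun setT (fun t : d.-tuple RM => cos (\sum_(i < d) a i * tnth t i)).
Proof.
apply: measurableT_comp; last exact: measurable_phase.
by apply: continuous_measurable_fun; exact: continuous_cos.
Qed.

Lemma measurable_sin_phase (a : 'I_d -> R) :
  measurable_fun setT (fun t : d.-tuple RM => sin (\sum_(i < d) a i * tnth t i)).
Proof.
apply: measurableT_comp; last exact: measurable_phase.
by apply: continuous_measurable_fun; exact: continuous_sin.
Qed.

Let twRe a (t : d.-tuple RM) := complex.Re (add_char a (tnth t) * F (tnth t)).
Let twIm a (t : d.-tuple RM) := complex.Im (add_char a (tnth t) * F (tnth t)).

Let twReE a t : twRe a t = cos (\sum_(i < d) a i * tnth t i) * Fr t -
   sin (\sum_(i < d) a i * tnth t i) * Fi t.
Proof. by rewrite /twRe /Fr /Fi /add_char; case: (F _). Qed.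

Let twImE a t : twIm a t = cos (\sum_(i < d) a i * tnth t i) * Fi t +
   sin (\sum_(i < d) a i * tnth t i) * Fr t.
Proof. by rewrite /twIm /Fr /Fi /add_char; case: (F _). Qed.

Let cosb x : `|cos x| <= 1 :> R.
Proof. by rewrite ler_norml cos_geN1 cos_le1. Qed.
Let sinb x : `|sin x| <= 1 :> R.
Proof. by rewrite ler_norml sin_geN1 sin_le1. Qed.

Let twRe_int a : (lebesgue_tuple d).-integrable (tbox d T) (EFin \o twRe a).
Proof.
apply: (@tbox_integrable _ _ _ (M + M)).
  rewrite (funext (twReE a)); apply: measurable_funB; apply: measurable_funM => //.
    exact: measurable_cos_phase.
  exact: measurable_sin_phase.
move=> t _; rewrite twReE (le_trans (ler_normB _ _))// lerD// normrM -[leRHS]mul1r ler_pM//.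
Qed.

Let twIm_int a : (lebesgue_tuple d).-integrable (tbox d T) (EFin \o twIm a).
Proof.
apply: (@tbox_integrable _ _ _ (M + M)).
  rewrite (funext (twImE a)); apply: measurable_funD; apply: measurable_funM => //.
    exact: measurable_cos_phase.
  exact: measurable_sin_phase.
move=> t _; rewrite twImE (le_trans (ler_normD _ _))// lerD// normrM -[leRHS]mul1r ler_pM//.
Qed.

Let cint_le a : Normc.normc (cintegral (lebesgue_tuple d) (tbox d T)
    (fun t : d.-tuple RM => add_char a (tnth t) * F (tnth t))) <= T ^+ d * E.
Proof.
have := hE a; rewrite /box_average Normc.normcM.
have -> : Normc.normc ((T ^- d)%:C)%C = T ^- d.
  by rewrite /= expr0n/= addr0 sqrtr_sqr ger0_norm// invr_ge0 exprn_ge0// ltW.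
by rewrite ler_pdivrMl ?exprn_gt0.
Qed.

Lemma integral_sumr (r : seq (R * ('I_d -> R))) (h : ('I_d -> R) -> d.-tuple RM -> R) :
  (forall a, (lebesgue_tuple d).-integrable (tbox d T) (EFin \o h a)) ->
  (lebesgue_tuple d).-integrable (tbox d T) (EFin \o (fun t => \sum_(p <- r) p.1 * h p.2 t)) /\
  \int[lebesgue_tuple d]_(t in tbox d T) (\sum_(p <- r) p.1 * h p.2 t) =
  \sum_(p <- r) p.1 * \int[lebesgue_tuple d]_(t in tbox d T) h p.2 t.
Proof.
move=> ih; have mB := @measurable_tbox R d T.
elim: r => [|p r [IHi IHe]].
  rewrite big_nil; under eq_fun do rewrite big_nil.
  split; last by rewrite Rintegral_cst// mul0r.
  exact: integrable0.
have iZ : (lebesgue_tuple d).-integrable (tbox d T) (EFin \o (fun t => p.1 * h p.2 t)).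
  exact: (integrableZl mB _ (ih p.2)).
under eq_fun do rewrite big_cons.
split; first exact: (integrableD mB iZ IHi).
by rewrite RintegralD// RintegralZl// IHe big_cons.
Qed.

(** The integral is linear in the kernel, and each character of its expansion
    contributes at most [T ^+ d * E] times the size of its coefficient. *)
Lemma twisted_kernel (G : ('I_d -> R) -> R) (A : R) (r : seq (R * ('I_d -> R))) : 0 <= E ->
  \sum_(p <- r) `|p.1| <= A ->
  (forall t, ((G t)%:C)%C = \sum_(p <- r) (p.1%:C)%C * add_char p.2 t) ->
  `|\int[lebesgue_tuple d]_(t in tbox d T) (G (tnth t) * Fr t)| <= T ^+ d * A * E /\
  `|\int[lebesgue_tuple d]_(t in tbox d T) (G (tnth t) * Fi t)| <= T ^+ d * A * E.
Proof.
move=> E0 rA GE.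
have GF t : ((G (tnth t))%:C)%C * F (tnth t) =
    \sum_(p <- r) (p.1%:C)%C * (add_char p.2 (tnth t) * F (tnth t)).
  by rewrite GE mulr_suml; apply: eq_bigr => p _; rewrite mulrA.
have final (h : ('I_d -> R) -> d.-tuple RM -> R) :
    (forall a, `|\int[lebesgue_tuple d]_(t in tbox d T) h a t| <= T ^+ d * E) ->
    `|\sum_(p <- r) p.1 * \int[lebesgue_tuple d]_(t in tbox d T) h p.2 t| <= T ^+ d * A * E.
  move=> hh; rewrite (le_trans (ler_norm_sum _ _ _))//.
  apply: (@le_trans _ _ (\sum_(p <- r) `|p.1| * (T ^+ d * E))).
    by apply: ler_sum => p _; rewrite normrM ler_wpM2l.
  by rewrite -mulr_suml [T ^+ d * A * E]mulrAC [leRHS]mulrC ler_wpM2r// mulr_ge0// exprn_ge0// ltW.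
split.
  rewrite (_ : (fun t => _) = (fun t => \sum_(p <- r) p.1 * twRe p.2 t)); last first.
    apply/funext => t; rewrite /Fr -Re_scale GF Re_sum.
    by apply: eq_bigr => p _; rewrite Re_scale.
  have [_ ->] := integral_sumr r twRe_int.
  by apply: final => a; rewrite (le_trans _ (cint_le a))//
    -[leLHS]/(`|complex.Re (cintegral _ _ _)|) normc_Re.
rewrite (_ : (fun t => _) = (fun t => \sum_(p <- r) p.1 * twIm p.2 t)); last first.
  apply/funext => t; rewrite /Fi -Im_scale GF Im_sum.
  by apply: eq_bigr => p _; rewrite Im_scale.
have [_ ->] := integral_sumr r twIm_int.
by apply: final => a; rewrite (le_trans _ (cint_le a))//
    -[leLHS]/(`|complex.Im (cintegral _ _ _)|) normc_Im.
Qed.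

End Twist.

(** * Choice of the scale and conclusion *)

Section Core.
Context {R : realType}.
Local Notation RM := (measurableTypeR R).

(** The Jackson kernels of period [K i] with [N] between [K i / delta] and
    [2 K i / delta] have first moment at most [2 delta] and coefficients of l^1
    norm at most [4 / delta].  Their product [G] satisfies the last hypothesis
    with [A = (4 / delta) ^+ d], and [quadrature] compares the integral of [G H]
    with the sum. *)
Lemma node_sum_bound d (K : 'I_d -> R) (T delta L M E : R) (H : d.-tuple R -> R) :
  0 < T -> 0 < delta -> (forall i, delta <= K i <= T) -> 0 <= L ->
  (forall s t, `|H s - H t| <= L * \sum_(i < d) `|tnth s i - tnth t i|) ->
  (forall t, `|H t| <= M) ->
  (forall (G : ('I_d -> R) -> R) (A : R) (r : seq (R * ('I_d -> R))),
    \sum_(p <- r) `|p.1| <= A ->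
    (forall t, ((G t)%:C)%C = \sum_(p <- r) (p.1%:C)%C * add_char p.2 t) ->
    `|\int[lebesgue_tuple d]_(t in tbox d T) (G (tnth t) * H t)| <= T ^+ d * A * E) ->
  `|\sum_(k <- grid (fun i => Num.truncn (T / K i))) H (node K k)|
  <= (\prod_(i < d) (2 * T / K i)) * \sum_(i < d) (L * (2 * delta) + K i / T * M)
     + T ^+ d * (4 / delta) ^+ d * E.
Proof.
move=> T0 dl0 hK L0 HL HM HT.
have K0 i : 0 < K i by have /andP[h _] := hK i; exact: lt_le_trans h.
have ex i : exists gr : (R -> R) * seq (R * R),
    [/\ quad_kernel (K i) (2 * delta) gr.1,
      \sum_(p <- gr.2) `|p.1| <= 4 / delta &
      forall x, ((gr.1 x)%:C)%C = \sum_(p <- gr.2) (p.1%:C)%C * cis (p.2 * x)].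
  have Kd0 : 0 < K i / delta by rewrite divr_gt0.
  pose N := (Num.truncn (K i / delta)).+1.
  have /andP[Nl Nu] : (Num.truncn (K i / delta))%:R <= K i / delta < N%:R.
    by apply: truncn_itv; exact: ltW.
  have N0 : 0 < N%:R :> R by rewrite ltr0n.
  have [g [r [[cg g0 g1 gm] rA rE]]] := jackson_kernel (K0 i) (ltn0Sn _ : (0 < N)%N).
  exists (g, r); split => //=.
    split => // k; apply: (le_trans (gm k)).
    rewrite ler_pdivrMr// -!mulrA ler_pM2l// mulrC.
    by rewrite -ler_pdivrMr// ltW.
  apply: (le_trans rA); rewrite ler_pdivrMr// mulrAC ler_pdivlMr//.
  have : N%:R <= K i / delta + 1 by rewrite -natr1 lerD2r.
  have : 1 <= K i / delta by rewrite ler_pdivlMr// mul1r; have /andP[] := hK i.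
  move=> h1 h2; have : N%:R <= 2 * (K i / delta) by lra.
  rewrite mulrA ler_pdivlMr//; lra.
pose g i := (projT1 (cid (ex i))).1.
have gq i : quad_kernel (K i) (2 * delta) (g i) by have [] := projT2 (cid (ex i)).
have gE i : exists r : seq (R * R), \sum_(p <- r) `|p.1| <= 4 / delta /\
    forall x, ((g i x)%:C)%C = \sum_(p <- r) (p.1%:C)%C * cis (p.2 * x).
  by have [_ h1 h2] := projT2 (cid (ex i)); exists (projT1 (cid (ex i))).2.
have gb i x : `|g i x| <= 4 / delta.
  have [r [rA rE]] := gE i; apply: le_trans rA.
  have /(congr1 (@complex.Re R)) := rE x; rewrite Re_sum /= => ->.
  apply: (le_trans (ler_norm_sum _ _ _)); apply: ler_sum => p _.
  rewrite mul0r subr0 normrM ler_piMr//.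
  by rewrite ler_norml cos_geN1 cos_le1.
have [r [rA rE]] := tensor_expansion (index_enum 'I_d) gE.
have := HT (fun t => \prod_(i < d) g i (t i)) _ r rA rE.
rewrite prodr_const card_ord => tw.
have hK' i : 0 < K i <= T by rewrite K0; have /andP[] := hK i.
have Q := quadrature T0 hK' gq gb L0 HL HM.
rewrite -normrN; set S := \sum_(k <- _) _ in Q *; set I := \int[_]_(_ in _) _ in Q tw.
have -> : - S = (I - S) - I by ring.
by rewrite (le_trans (ler_normB _ _))// lerD.
Qed.

End Core.

Section Powers.
Context {R : realType}.

(** [delta] is chosen so that the smoothing error, proportional to [delta / |K|],
    equals the equidistribution error, proportional to [r ^ -b delta ^ -d]. *)
Lemma optimal_scale (d : nat) (b r Kd : R) : 0 < b -> 0 < r -> 0 < Kd ->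
  let delta := (Kd * r `^ (- b)) `^ ((d%:R + 1)^-1) in
  [/\ 0 < delta, delta / Kd = r `^ (- (b / (d%:R + 1))) * Kd `^ (- (d%:R / (d%:R + 1))) &
      r `^ (- b) * delta ^- d = delta / Kd].
Proof.
move=> b0 r0 Kd0 delta.
have d1 : 0 < d%:R + 1 :> R by rewrite ltr_wpDl.
have x0 : 0 < Kd * r `^ (- b) by rewrite mulr_gt0// powR_gt0.
have dl0 : 0 < delta by rewrite powR_gt0.
split => //.
  rewrite /delta powRM ?powR_ge0// ?ltW// -powRrM mulrAC mulrC mulNr; congr (_ * _).
  apply: (mulIf (lt0r_neq0 Kd0)); rewrite divfK ?gt_eqF//.
  rewrite -[X in _ * X]powRr1 ?(ltW Kd0)// -powRD; last by rewrite (gt_eqF Kd0) implybT.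
  by congr (_ `^ _); field; rewrite gt_eqF.
have : delta ^+ d.+1 = Kd * r `^ (- b).
  rewrite /delta -powR_mulrn ?powR_ge0// -powRrM -[d.+1%:R]natr1 mulVf ?gt_eqF// powRr1 ?(ltW x0)//.
move=> E; apply/eqP; rewrite eqr_div ?(lt0r_neq0 Kd0) ?(lt0r_neq0 (exprn_gt0 d dl0))//.
by rewrite -exprS E mulrC.
Qed.

(** Raised to the power [b], the hypothesis reads
    [(2 / mK) ^ (d + 1) |K| < r ^ b], that is [(2 delta / mK) ^ (d + 1) < 1]. *)
Lemma optimal_scale_lt (d : nat) (b r Kd mK : R) : 0 < b -> 0 < r -> 0 < Kd -> 0 < mK ->
  (2 / mK) `^ ((d%:R + 1) / b) * Kd `^ b^-1 < r ->
  (Kd * r `^ (- b)) `^ ((d%:R + 1)^-1) <= mK.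
Proof.
move=> b0 r0 Kd0 mK0 H.
have d1 : 0 < d%:R + 1 :> R by rewrite ltr_wpDl.
have H1 : (2 / mK) `^ (d%:R + 1) * Kd < r `^ b.
  have := gt0_ltr_powR b0 _ _ H.
  rewrite !nnegrE mulr_ge0 ?powR_ge0 ?(ltW r0)// => /(_ isT isT).
  rewrite powRM ?powR_ge0// -!powRrM divfK ?gt_eqF// mulVf ?gt_eqF// powRr1 ?(ltW Kd0)//.
have H2 : Kd * r `^ (- b) <= mK `^ (d%:R + 1).
  rewrite powRN ler_pdivrMr ?powR_gt0//.
  have two : mK `^ (d%:R + 1) * (2 / mK) `^ (d%:R + 1) = 2 `^ (d%:R + 1).
    by rewrite -powRM ?divr_ge0 ?(ltW mK0)// mulrC divfK ?gt_eqF.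
  have two1 : 1 <= 2 `^ (d%:R + 1) :> R.
    by rewrite -[leLHS](powRr0 2) ler_powR ?ler1n// ltW.
  apply: (@le_trans _ _ (2 `^ (d%:R + 1) * Kd)); first by rewrite ler_peMl// ltW.
  by rewrite -two -mulrA ler_wpM2l ?powR_ge0// ltW.
have -> : mK = (mK `^ (d%:R + 1)) `^ (d%:R + 1)^-1.
  by rewrite -powRrM mulfV ?lt0r_neq0// powRr1// ltW.
apply: ge0_ler_powR; rewrite ?nnegrE ?invr_ge0 ?powR_ge0 ?(ltW d1)//.
by rewrite mulr_ge0 ?powR_ge0// ltW.
Qed.

End Powers.

Section Part.
Context {R : realType} {n d : nat} (mX : probability (borelX R n) R).
Hypothesis (inv : right_invariant mX).
Variables (B : (\dim (@slie R n)).-tuple 'M[R]_n) (hB : basis_of (@slie R n) B).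
Variables (l : nat) (l1 : (1 <= l)%N) (f : X R n -> R[i]) (s : R).
Hypothesis fs : sobolev mX B l f = s%:E.

Lemma orbit_part_bounds (p : R[i] -> R) (m : nat) (e : block_coord n m d) (g0 : SL R n) :
  (forall z, `|p z| <= Normc.normc z) ->
  (forall Y x, p (lie_derive Y f x) = real_lie_derive Y (p \o f) x) ->
  smooth_SL (p \o f \o @piX R n) ->
  [/\ forall x, `|p (f x)| <= s,
      forall t t' : d.-tuple R, `|p (f (actX (piX g0) (horo e (tnth t))))
         - p (f (actX (piX g0) (horo e (tnth t'))))|
         <= basis_const B * s * \sum_(i < d) `|tnth t i - tnth t' i| &
      `|\int[mX]_(x in setT) p (f x)| <= s].
Proof.
move=> hp pE sp.
have cp : continuous (p \o f) := smooth_SL_continuous sp.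
have ps := sobolev_sup inv fs hp cp.
split => //.
  move=> t t'.
  apply: (orbit_lipschitz e hB g0 (sobolev_fin_ge0 fs) sp).
  exact: (sobolev_lie_sup inv hB l1 fs hp pE sp).
exact: (mean_le mX cp ps).
Qed.

End Part.

Lemma ell_ge1 n : (2 <= n)%N -> (1 <= ell n)%N.
Proof. by move=> n2; rewrite /ell divn_gt0//; case: n n2 => [|[|n]]//= _; lia. Qed.

Theorem theorem4p1 (R : realType) (n d : nat) (hn : (2 <= n)%N)
    (mX : probability (borelX R n) R) (hmX : right_invariant mX)
    (B : (\dim (@slie R n)).-tuple 'M[R]_n) (hB : basis_of (@slie R n) B)
    (C b : R) (hC : 0 < C) (hb : 0 < b < 1)
    (hequid : effective_equidistribution mX B d C)
    (htwist : twisted_equidistribution mX B d C b) :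
  exists c : R, 0 < c /\
    forall (m : nat) (e : block_coord n m d), (1 <= m < n)%N ->
      d = (m * (n - m))%N ->
    forall (T r : R) (K : 'I_d -> R) (g0 : SL R n) (f : X R n -> R[i]),
      (forall i, 1 <= K i <= T) ->
      Dio (horo e) T r g0 ->
      CK K C b T < r < T ->
      Cc_infty f ->
      ((Normc.normc
          (orbit_sum (horo e) g0 K T f
           - ((T ^+ d / detK K)%:C)%C * mean_X mX f))%:E
       <= (c * (T ^+ d * r `^ (- (b / (d%:R + 1)))
                  * detK K `^ (- (d%:R / (d%:R + 1)))
                + T ^+ (d - 1) * maxK K / detK K))%:E
          * sobolev mX B (ell n) f)%E.
Proof.
have [ct [ct0 htw]] := htwist.
have /andP[b0 b1] := hb.
pose cB := basis_const B.
have cB0 : 0 <= cB by apply: sumr_ge0 => ij _; apply: sumr_ge0.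
(* c1 collects the smoothing errors, c2 the equidistribution error and c3 the
   boundary terms: 2 from the quadrature, 1 from the number of nodes.  The real
   and the imaginary part each contribute the sum of the three. *)
pose c1 : R := 2 ^+ d * (d%:R * (2 * cB)).
pose c2 : R := 4 ^+ d * ct.
pose c3 : R := 3 * 2 ^+ d * d%:R.
have c10 : 0 <= c1 by rewrite mulr_ge0 ?exprn_ge0// mulr_ge0// mulr_ge0.
have c20 : 0 < c2 by rewrite mulr_gt0// exprn_gt0.
have c30 : 0 <= c3 by rewrite mulr_ge0// mulr_ge0// exprn_ge0.
exists (2 * (c1 + c2 + c3)); split.
  by rewrite mulr_gt0// ltr_wpDr// ltr_wpDl.
move=> m e mn dE T r K g0 f hK hDio /andP[rCK rT] hf.
have d0 : (0 < d)%N.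
  by move: mn => /andP[m1 mltn]; rewrite dE muln_gt0 m1 subn_gt0.
have r0 : 0 < r.
  by apply: le_lt_trans rCK; rewrite /CK le_max (ltW hC).
have rC : C < r by apply: le_lt_trans rCK; rewrite /CK le_max lexx.
have T0 : 0 < T := lt_trans r0 rT.
have K0 i : 0 < K i by have /andP[h _] := hK i; exact: lt_le_trans h.
have KT i : K i <= T by have /andP[] := hK i.
have Kd0 : 0 < detK K by apply: prodr_gt0.
have mK i : K i <= maxK K by exact: le_bigmax.
have mK0 : 0 < maxK K := lt_le_trans (K0 (Ordinal d0)) (mK _).
set X1 := T ^+ d * r `^ (- (b / (d%:R + 1))) * detK K `^ (- (d%:R / (d%:R + 1))).
set X2 := T ^+ (d - 1) * maxK K / detK K.
have X10 : 0 < X1 by rewrite !mulr_gt0 ?exprn_gt0 ?powR_gt0.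
have X20 : 0 < X2 by rewrite divr_gt0// mulr_gt0// exprn_gt0.
case fs : (sobolev mX B (ell n) f) => [s| |]; last 2 first.
- rewrite gt0_muley ?leey// lte_fin mulr_gt0 ?addr_gt0// mulr_gt0//.
  by rewrite ltr_wpDr// ltr_wpDl.
- have : (0 <= sobolev mX B (ell n) f)%E.
    by apply: sume_ge0 => k' _; apply: sume_ge0 => t' _; exact: Lnorm_ge0.
  by rewrite fs.
have s0 := sobolev_fin_ge0 fs.
rewrite -EFinM lee_fin.
have [sRe sIm _] := hf.
have l1 := ell_ge1 hn.
have [Re1 Re2 Re3] := orbit_part_bounds hmX hB l1 fs e g0 (@normc_Re R)
  (fun _ _ => erefl) sRe.
have [Im1 Im2 Im3] := orbit_part_bounds hmX hB l1 fs e g0 (@normc_Im R)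
  (fun _ _ => erefl) sIm.
pose mv := mean_X mX f.
pose Fc (t : 'I_d -> R) := f (actX (piX g0) (horo e t)) - mv.
pose E := ct * r `^ (- b) * s.
have E0 : 0 <= E by rewrite mulr_ge0// mulr_ge0 ?powR_ge0// ltW.
have hE a : Normc.normc (box_average T (fun t => add_char a t * Fc t)) <= E.
  have := htw m e mn dE T r g0 f a hDio _ hf.
  by rewrite rC rT fs => /(_ isT); rewrite -EFinM lee_fin.
pose Fr (t : d.-tuple R) := complex.Re (Fc (tnth t)).
pose Fi (t : d.-tuple R) := complex.Im (Fc (tnth t)).
have FrE t : Fr t = complex.Re (f (actX (piX g0) (horo e (tnth t)))) - complex.Re mv.
  exact: Re_sub.
have FiE t : Fi t = complex.Im (f (actX (piX g0) (horo e (tnth t)))) - complex.Im mv.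
  exact: Im_sub.
have FrL u v : `|Fr u - Fr v| <= cB * s * \sum_(i < d) `|tnth u i - tnth v i|.
  by rewrite !FrE opprB addrA subrK; exact: Re2.
have FiL u v : `|Fi u - Fi v| <= cB * s * \sum_(i < d) `|tnth u i - tnth v i|.
  by rewrite !FiE opprB addrA subrK; exact: Im2.
have FrM t : `|Fr t| <= 2 * s.
  by rewrite FrE (le_trans (ler_normB _ _))// mulr2n mulrDl mul1r lerD.
have FiM t : `|Fi t| <= 2 * s.
  by rewrite FiE (le_trans (ler_normB _ _))// mulr2n mulrDl mul1r lerD.
have L0 : 0 <= cB * s by rewrite mulr_ge0.
have mFr := lipschitz_measurable L0 FrL.
have mFi := lipschitz_measurable L0 FiL.
pose delta := (detK K * r `^ (- b)) `^ ((d%:R + 1)^-1).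
have [dl0 dl1 dl2] : [/\ 0 < delta,
    delta / detK K = r `^ (- (b / (d%:R + 1))) * detK K `^ (- (d%:R / (d%:R + 1))) &
    r `^ (- b) * delta ^- d = delta / detK K] := optimal_scale d b0 r0 Kd0.
have minK0 : 0 < minK K T.
  by rewrite /minK; elim/big_ind: _ => // x y x0 y0; rewrite lt_min x0.
have dlK i : delta <= K i.
  apply: (@le_trans _ _ (minK K T)); last exact: bigmin_le.
  apply: optimal_scale_lt => //; apply: le_lt_trans rCK.
  by rewrite /CK le_max lexx orbT.
clearbody delta.
have dlKT i : delta <= K i <= T by rewrite dlK KT.
have tw G A q E1 E2 := @twisted_kernel R d T E (2 * s) Fc T0 mFr mFi FrM FiM hE G A q E0 E1 E2.
have NRe := node_sum_bound T0 dl0 dlKT L0 FrL FrM (fun G A q E1 E2 => (tw G A q E1 E2).1).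
have NIm := node_sum_bound T0 dl0 dlKT L0 FiL FiM (fun G A q E1 E2 => (tw G A q E1 E2).2).
pose gr := grid (fun i => Num.truncn (T / K i)).
pose Q := T ^+ d / detK K.
have Q0 : 0 <= Q by rewrite divr_ge0 ?exprn_ge0// ltW.
have QE : \prod_(i < d) (T / K i) = Q.
  by rewrite big_split/= prodr_const card_ord prodfV.
have Q2E : \prod_(i < d) (2 * T / K i) = 2 ^+ d * Q.
  by rewrite -QE -[X in _ ^+ X]card_ord -prodr_const -big_split/=;
    apply: eq_bigr => i _; rewrite mulrA.
have SK : \sum_(i < d) K i / T <= d%:R * (maxK K / T).
  rewrite mulr_natl -[X in _ *+ X]card_ord -sumr_const; apply: ler_sum => i _.
  by rewrite ler_wpM2r// invr_ge0 ltW.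
have QX1 : Q * delta = X1.
  by rewrite /X1 -[RHS]mulrA -dl1 /Q mulrAC mulrA.
have QX2 : Q * (maxK K / T) = X2.
  have TdE : T ^+ d = T ^+ (d - 1) * T by rewrite -exprSr subn1 prednK.
  by rewrite /X2 /Q TdE; field; rewrite !gt_eqF.
have EX1 : T ^+ d * (4 / delta) ^+ d * E = c2 * X1 * s.
  have -> : X1 = T ^+ d * (r `^ (- b) * delta ^- d) by rewrite dl2 -QX1 /Q mulrAC -mulrA.
  by rewrite /E /c2 expr_div_n; ring.
have count : `|\prod_(i < d) (Num.truncn (T / K i)).+1%:R - Q|
    <= 2 ^+ d * Q * (d%:R * (maxK K / T)).
  rewrite -QE; apply: le_trans (prod_near _ _) _.
  - by move=> i; rewrite ler_pdivlMr// mul1r.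
  - move=> i; have /andP[t1 t2] := truncn_bounds (K0 i) (KT i).
    rewrite -[_.+1%:R]natr1; apply/andP; split.
      by rewrite ler_pdivrMr// mulrDl mul1r ltW.
    by rewrite lerD2r ler_pdivlMr.
  - rewrite QE -Q2E (eq_bigr (fun i => 2 * T / K i)) => [|i _]; last by rewrite mulrA.
    rewrite ler_wpM2l//; first by rewrite Q2E mulr_ge0// exprn_ge0.
    by rewrite (eq_bigr (fun i => K i / T)) => [//|i _]; rewrite invf_div.
have part (H h : d.-tuple R -> R) (mr : R) : (forall t, H t = h t - mr) -> `|mr| <= s ->
    `|\sum_(k <- gr) H (node K k)| <= (\prod_(i < d) (2 * T / K i)) *
      \sum_(i < d) (cB * s * (2 * delta) + K i / T * (2 * s)) + T ^+ d * (4 / delta) ^+ d * E ->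
    `|\sum_(k <- gr) h (node K k) - Q * mr| <= (c1 + c2 + c3) * (X1 + X2) * s.
  move=> Hh mrs; rewrite (eq_bigr _ (fun k _ => Hh (node K k))) sumrB sum_grid_const.
  set Sh := \sum_(k <- gr) _; set N := \prod_(i < d) _ => bound.
  have -> : Sh - Q * mr = (Sh - N * mr) + (N - Q) * mr by ring.
  apply: (le_trans (ler_normD _ _)); rewrite normrM.
  have cnt := ler_pM (normr_ge0 _) (normr_ge0 _) count mrs.
  apply: (le_trans (lerD bound cnt)).
  rewrite Q2E EX1 big_split/= sumr_const card_ord -mulr_suml -[_ *+ d]mulr_natl.
  apply: (@le_trans _ _
    (2 ^+ d * Q * (d%:R * (cB * s * (2 * delta)) + d%:R * (maxK K / T) * (2 * s))
    + c2 * X1 * s + 2 ^+ d * Q * (d%:R * (maxK K / T)) * s)).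
    rewrite !lerD2r ler_wpM2l//; first by rewrite mulr_ge0// exprn_ge0.
    by rewrite lerD2l ler_wpM2r// mulr_ge0.
  have -> : 2 ^+ d * Q * (d%:R * (cB * s * (2 * delta)) + d%:R * (maxK K / T) * (2 * s))
    + c2 * X1 * s + 2 ^+ d * Q * (d%:R * (maxK K / T)) * s =
    c1 * (Q * delta) * s + c2 * X1 * s + c3 * (Q * (maxK K / T)) * s.
    by rewrite /c1 /c3; ring.
  rewrite QX1 QX2 -!mulrDl ler_wpM2r//.
  have -> : (c1 + c2 + c3) * (X1 + X2) = ((c1 + c2) * X1 + c3 * X2) + (c3 * X1 + (c1 + c2) * X2).
    by ring.
  by rewrite lerDl addr_ge0// mulr_ge0// ?addr_ge0// ltW.
have PRe := part _ _ _ FrE Re3 NRe.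
have PIm := part _ _ _ FiE Im3 NIm.
rewrite (orbit_sum_grid _ _ _ T0 K0).
apply: (le_trans (normc_le_ReIm _)).
rewrite Re_sub Im_sub Re_sum Im_sum Re_scale Im_scale.
have -> : 2 * (c1 + c2 + c3) * (X1 + X2) * s =
  (c1 + c2 + c3) * (X1 + X2) * s + (c1 + c2 + c3) * (X1 + X2) * s by ring.
exact: lerD PRe PIm.
Qed.
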